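(* Let $w\in\mathbb{R}$, let $\mu=\delta_w$, and let $\nu$ be an atomless (i.e. having a continuous distribution function) integrable probability measure on $\mathbb{R}$ with mean $w$. Let $K_2<K_1$ with $K_1>w$, and let $\ell_\nu<r_\nu$ be the (possibly infinite) endpoints of the smallest interval containing the support of $\nu$. Suppose that $$\frac{K_1-w}{r_\nu-w}<\frac{(K_2-\ell_\nu)-(K_1-w)}{w-\ell_\nu},$$ where the left-hand side is read as $0$ if $r_\nu=\infty$ and the right-hand side is read as $1$ if $\ell_\nu=-\infty$. Then $$\mathcal{P}_N=\sup_{u\in[0,1]}A(u)=\mathcal{D},$$ where $\mathcal{P}_N$ is the highest model-based price of the American put with strikes $K_1,K_2$, $A(u)$ is the value of the put in the model described in the context under the rule of exercising at time $1$ exactly when $U<u$, and $\mathcal{D}$ is the dual (superhedging) bound described in the context.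
   Context: Consistent models and $\mathcal{P}_N$. A $(\mu,\nu)$-consistent model is a pair $(\mathcal{S},X)$, where $\mathcal{S}=(\Omega,\mathcal{F},\mathbb{P},\mathbb{F}=\{\mathcal{F}_0,\mathcal{F}_1,\mathcal{F}_2\})$ is a filtered probability space and $X=(X_0,X_1,X_2)$ is an $\mathbb{F}$-martingale with $X_0=\int x\,\mu(dx)$, $X_1\sim\mu$, $X_2\sim\nu$. The American put pays $(K_\tau-X_\tau)^+$ when exercised at $\tau\in\{1,2\}$. Its price in the model is $\mathcal{A}(\mathcal{S},X)=\sup_\tau\mathbb{E}[(K_\tau-X_\tau)^+]$, the supremum being over $\mathbb{F}$-stopping times $\tau$ with values in $\{1,2\}$, and $\mathcal{P}_N=\sup_{(\mathcal{S},X)}\mathcal{A}(\mathcal{S},X)$, the supremum being over all $(\mu,\nu)$-consistent models. The function $A$. For $u\in(0,1)$ let $R(u)\leq w\leq S(u)$, with $R$ decreasing and $S$ increasing in $u$, satisfy $$u=\int_{R(u)}^{S(u)}\nu(dz),\qquad 0=\int_{R(u)}^{S(u)}(z-w)\,\nu(dz).$$ Let $U,V$ be independent uniform random variables on $(0,1)$, $\mathcal{F}_0$ trivial, $\mathcal{F}_1=\sigma(U)$, $\mathcal{F}_2=\sigma(U,V)$, $X_0=X_1=w$, and $X_2=R(U)$ if $V\leq\frac{S(U)-w}{S(U)-R(U)}$, $X_2=S(U)$ otherwise; this is a $(\delta_w,\nu)$-consistent model. For $u\in[0,1]$ let $\tau_u=1$ if $U<u$ and $\tau_u=2$ otherwise,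 and let $A(u)=\mathbb{E}[(K_{\tau_u}-X_{\tau_u})^+]$. Thus for $u\in(0,1)$ $$A(u)=(K_1-w)u+\int_{-\infty}^{R(u)}(K_2-z)^+\nu(dz)+\int_{S(u)}^{\infty}(K_2-z)^+\nu(dz),$$ while $A(0)=\int(K_2-z)^+\nu(dz)$ and $A(1)=K_1-w$. The bound $\mathcal{D}$. For a convex function $\psi:\mathbb{R}\to\mathbb{R}$ with $\psi(z)\geq(K_2-z)^+$ for all $z$, set $\mathcal{D}(\psi)=((K_1-w)^+-\psi(w))^++\int\psi(y)\,\nu(dy)\in[0,\infty]$, and let $\mathcal{D}=\inf_\psi\mathcal{D}(\psi)$ over all such $\psi$. *)

(* Defs.v *)
From HB Require Import structures.
From mathcomp Require Import all_boot all_order all_algebra.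
From mathcomp Require Import all_classical all_reals all_analysis.

Set Implicit Arguments.
Unset Strict Implicit.
Unset Printing Implicit Defensive.

Import Order.TTheory GRing.Theory Num.Theory.
Import numFieldNormedType.Exports.

Local Open Scope classical_set_scope.
Local Open Scope ring_scope.

(* The three dates 0, 1, 2; all processes and filtrations are indexed by 'I_3. *)
Definition t0 : 'I_3 := @Ordinal 3 0 isT.
Definition t1 : 'I_3 := @Ordinal 3 1 isT.
Definition t2 : 'I_3 := @Ordinal 3 2 isT.

Section FilteredSpace.
Context (R : realType) (d : measure_display) (Omega : measurableType d).
Variable P : probability Omega R.
Implicit Types (F : 'I_3 -> set (set Omega)) (X : 'I_3 -> Omega -> R).

Definition filtration F : Prop :=
  [/\ forall t, sigma_algebra setT (F t),
      forall t, F t `<=` measurable &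
      forall s t : 'I_3, (s <= t)%N -> F s `<=` F t].

Definition adapted F X : Prop :=
  forall (t : 'I_3) (B : set R), measurable B -> F t (X t @^-1` B).

(* The last clause says that X s is a version of the conditional expectation
   of X t given F s. *)
Definition martingale F X : Prop :=
  [/\ adapted F X,
      forall t, P.-integrable setT (EFin \o X t) &
      forall s t : 'I_3, (s <= t)%N -> forall A, F s A ->
        (\int[P]_(x in A) (X t x)%:E = \int[P]_(x in A) (X s x)%:E)%E].

Definition has_law (Y : Omega -> R) (m : probability (measurableTypeR R) R) : Prop :=
  forall B : set R, measurable B -> P (Y @^-1` B) = m B.

Definition consistent_model (mu nu : probability (measurableTypeR R) R) F X : Prop :=
  [/\ filtration F,
      martingale F X,
      {ae P, forall x, (X t0 x)%:E = (\int[mu]_y y%:E)%E},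
      has_law (X t1) mu &
      has_law (X t2) nu].

(* Stopping times with values in {1, 2}. *)
Definition exercise_time F (tau : Omega -> 'I_3) : Prop :=
  (forall x, tau x = t1 \/ tau x = t2) /\
  (forall t : 'I_3, F t [set x | (tau x <= t)%N]).

(* There is no strike at date 0: only dates 1 and 2 are used. *)
Definition strike (K1 K2 : R) (t : 'I_3) : R := if t == t1 then K1 else K2.

Definition put_payoff (K1 K2 : R) X (tau : Omega -> 'I_3) (x : Omega) : R :=
  Num.max (strike K1 K2 (tau x) - X (tau x) x) 0.

Definition american_price (K1 K2 : R) F X : \bar R :=
  ereal_sup [set 'E_P[put_payoff K1 K2 X tau]%E | tau in exercise_time F].

End FilteredSpace.

Definition highest_model_price (R : realType) (mu nu : probability (measurableTypeR R) R)
    (K1 K2 : R) : \bar R :=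
  ereal_sup [set p | exists (d : measure_display) (Omega : measurableType d)
      (P : probability Omega R) (F : 'I_3 -> set (set Omega))
      (X : 'I_3 -> Omega -> R),
      consistent_model P mu nu F X /\ p = american_price P K1 K2 F X].

Section IntervalModel.
Context (R : realType).
Implicit Types (nu : probability (measurableTypeR R) R) (w : R) (lo hi : R -> R).

(* lo and hi are the functions R(.) and S(.); only their values on ]0, 1[
   matter. *)
Definition barycentric_intervals nu w lo hi : Prop :=
  [/\ {in `]0, 1[ &, {homo lo : u v /~ u <= v}},
      {in `]0, 1[ &, {homo hi : u v / u <= v}} &
      {in `]0, 1[, forall u,
        [/\ lo u <= w <= hi u,
            nu `[lo u, hi u]%classic = u%:E &
            (\int[nu]_(z in `[lo u, hi u]) (z - w)%:E = 0)%E]}].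

Definition uniform01 : probability (measurableTypeR R) R := uniform_prob (@ltr01 R).

(* The sample point is (U, V), so that U and V are independent and uniform. *)
Definition uniform_square :
    probability (measurableTypeR R * measurableTypeR R)%type R :=
  (uniform01 \x uniform01)%E.

(* U lies in ]0, 1[ almost surely; off this event the terminal value is
   immaterial and set to w. *)
Definition terminal_value w lo hi (x : R * R) : R :=
  let: (U, V) := x in
  if U \in `]0, 1[ then
    if V <= (hi U - w) / (hi U - lo U) then lo U else hi U
  else w.

Definition interval_process w lo hi (t : 'I_3) : R * R -> R :=
  if t == t2 then terminal_value w lo hi else cst w.

Definition threshold_time (u : R) (x : R * R) : 'I_3 :=
  if x.1 < u then t1 else t2.

Definition threshold_value w lo hi (K1 K2 : R) (u : R) : \bar R :=
  ('E_uniform_square[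
     put_payoff K1 K2 (interval_process w lo hi) (threshold_time u)])%E.

End IntervalModel.

Section Dual.
Context (R : realType).
Implicit Types (nu : probability (measurableTypeR R) R) (w : R) (psi : R -> R).

Definition dual_admissible (K2 : R) psi : Prop :=
  convex_function (setT : set R) psi /\
  forall z, Num.max (K2 - z) 0 <= psi z.

Definition dual_cost nu w (K1 : R) psi : \bar R :=
  ((Num.max (Num.max (K1 - w) 0 - psi w) 0)%:E + \int[nu]_y (psi y)%:E)%E.

Definition dual_bound nu w (K1 K2 : R) : \bar R :=
  ereal_inf [set dual_cost nu w K1 psi | psi in dual_admissible K2].

End Dual.

Section Support.
Context (R : realType).
Implicit Types (nu : probability (measurableTypeR R) R) (w : R).

Definition atomless nu : Prop := continuous (fun x : R => fine (nu `]-oo, x]%classic)).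

Definition topological_support nu : set R :=
  [set x | forall U : set R, open U -> U x -> (0 < nu U)%E].

(* Endpoints of the smallest interval containing the support. *)
Definition left_endpoint nu : \bar R :=
  ereal_inf (EFin @` topological_support nu).

Definition right_endpoint nu : \bar R :=
  ereal_sup (EFin @` topological_support nu).

(* A nonempty support rules out right_endpoint nu = -oo and
   left_endpoint nu = +oo, so each default branch below is taken exactly when
   the endpoint is infinite on its own side. *)
Definition right_ratio nu w (K1 : R) : R :=
  if right_endpoint nu is r%:E then (K1 - w) / (r - w) else 0.

Definition left_ratio nu w (K1 K2 : R) : R :=
  if left_endpoint nu is l%:E then ((K2 - l) - (K1 - w)) / (w - l) else 1.

End Support.

(* Main.v *)
Require Import Defs.
From HB Require Import structures.
From mathcomp Require Import all_boot all_order all_algebra.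
From mathcomp Require Import all_classical all_reals all_analysis.
From mathcomp Require Import measurable_realfun.
From mathcomp Require Import ring lra.

(* In any model the event A = {tau = 1} is known at date 1. If psi is convex and
   dominates (K2 - z)^+, with slope m at w, then holding the claim psi(X_2), the
   cash ((K1 - w)^+ - psi(w))^+ and, on A, -m units of stock from date 1 on
   superhedges the put; taking expectations gives P_N <= D.

   Conversely, in the interval model draw the chord of k(z) = (K2 - z)^+ over
   [R(u), S(u)]. Its height at w increases with u, from below K1 - w up to a
   value above K1 - w (this is the endpoint condition). At the crossing u0 some
   line L through (w, K1 - w) satisfies L >= k at R(u), S(u) for u < u0 and
   L <= k there for u > u0. With psi = max(L, k) the superhedge is then exact
   almost surely for the rule "exercise when U < u0", so A(u0) = D(psi).

   That X_2 has law nu in the interval model is seen as follows: for u < v the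
   nu-mass of [R(v), R(u)[ and the probability of {u < U <= v, X_2 = R(U)} both
   lie between (v - u) (S(u) - w) / (S(u) - R(v)) and
   (v - u) (S(v) - w) / (S(v) - R(u)), and the gap between these bounds is
   negligible after summation over a fine partition. *)

Set Implicit Arguments.
Unset Strict Implicit.
Unset Printing Implicit Defensive.

Import Order.TTheory GRing.Theory Num.Theory.
Import numFieldNormedType.Exports.
Local Open Scope classical_set_scope.
Local Open Scope ring_scope.

(** * Distribution functions and first moments, existence of the intervals *)

(** For the intervals and the law of X_2, nu enters only through F(x) = nu(]-oo, x]) and M(x), the
    integral of z - w over ]-oo, x]. The two-sided bound [mc_bound] stands in for dM = (z - w) dF
    and turns statements on masses and moments into inequalities between increments. The obstacle is
    that nu may have gaps: R and S may then jump and are not unique, so one can neither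
    differentiate them nor assume that they attain a given x. The chord may likewise jump past K1 -
    w, so that no interval has its chord through (w, K1 - w). The slope of L is therefore squeezed
    between the slopes of the segments from this point to the graph of k at R(u) and S(u), on both
    sides of u0. A gap around w can put the chord above K1 - w for all u; then u0 = 0. The endpoint
    condition provides k such that the line of slope -k through (w, K1 - w) meets K2 - z right of
    the left endpoint and vanishes left of the right endpoint. Once [R(u), S(u)] contains both
    points, its chord lies on or above that line. *)

Record moment_cdf (R : realType) (w : R) (F M : R -> R) : Prop := MomentCdf {
  mc_mono : {homo F : x y / x <= y};
  mc_cont : continuous F;
  mc_bound : forall x y, x <= y ->
    (x - w) * (F y - F x) <= M y - M x <= (y - w) * (F y - F x);
  mc_F0 : forall e, 0 < e -> exists x0, forall x, x <= x0 -> `|F x| < e;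
  mc_F1 : forall e, 0 < e -> exists x0, forall x, x0 <= x -> `|1 - F x| < e;
  mc_M0 : forall e, 0 < e -> exists x0, forall x, x <= x0 -> `|M x| < e;
  mc_M1 : forall e, 0 < e -> exists x0, forall x, x0 <= x -> `|M x| < e
}.

Arguments mc_cont {R w F M} _.
Arguments mc_F0 {R w F M} _ {e} _.
Arguments mc_F1 {R w F M} _ {e} _.
Arguments mc_M0 {R w F M} _ {e} _.
Arguments mc_M1 {R w F M} _ {e} _.

Lemma continuousP_dist (R : realType) (f : R -> R) (x : R) : {for x, continuous f} <->
  forall e : R, 0 < e -> exists2 d : R, 0 < d &
    forall y : R, `|x - y| < d -> `|f x - f y| < e.
Proof.
split=> [/cvgrPdist_lt h e e0|h].
  have /nbhs_ballP[d /= d0 H] := h _ e0; exists d => // y xy; exact: H.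
apply/cvgrPdist_lt => e e0; have [d d0 H] := h _ e0.
by apply/nbhs_ballP; exists d => //= y xy; exact: H.
Qed.

Lemma lip1_continuous (R : realType) (f : R -> R) :
  (forall x y, x <= y -> `|f y - f x| <= y - x) -> continuous f.
Proof.
move=> H x; apply/continuousP_dist => e e0; exists e => // y hy.
apply: le_lt_trans hy; have [xy|yx] := leP x y.
  rewrite distrC (le_trans (H _ _ xy))// -normrN opprB; exact: ler_norm.
by apply: (le_trans (H _ _ (ltW yx))); exact: ler_norm.
Qed.

Section MomentCdfTheory.
Context (R : realType) (w : R) (F M : R -> R) (FM : moment_cdf w F M).

Lemma moment_homo_right x y : w <= x -> x <= y -> M x <= M y.
Proof.
move=> wx xy; have /andP[h _] := mc_bound FM xy.
by have := mc_mono FM xy; nra.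
Qed.

Lemma moment_homo_left x y : x <= y -> y <= w -> M y <= M x.
Proof.
move=> xy yw; have /andP[_ h] := mc_bound FM xy.
by have := mc_mono FM xy; nra.
Qed.

Lemma moment_continuous : continuous M.
Proof.
move=> x; apply/continuousP_dist => e e0.
(* Within distance 1 of x the weight |z - w| is at most C, so increments of M are at most C times
   those of F. *)
pose C := `|x - w| + 1.
have C0 : 0 < C by rewrite /C; have := normr_ge0 (x - w); lra.
have /continuousP_dist/(_ (e / C) (divr_gt0 e0 C0))[d d0 Hd] := mc_cont FM x.
exists (Num.min d 1) => [|y]; first by rewrite lt_min d0/= ltr01.
rewrite lt_min => /andP[/Hd hF hy].
rewrite ltr_pdivlMr// in hF.
apply: le_lt_trans hF.
have K : (x - y < 1) /\ (y - x < 1) by move: hy; rewrite ltr_norml; lra.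
have [xy|yx] := leP x y.
  have /andP[h1 h2] := mc_bound FM xy.
  have mF := mc_mono FM xy.
  rewrite (distrC (F x)) (ger0_norm (_ : 0 <= F y - F x)) ?subr_ge0//.
  rewrite ler_norml /C; apply/andP.
  have [wx|xw] := leP w x.
    rewrite (ger0_norm (_ : 0 <= x - w)) ?subr_ge0//; split; nra.
  by rewrite (ltr0_norm (_ : x - w < 0)) ?subr_lt0//; split; nra.
have /andP[h1 h2] := mc_bound FM (ltW yx).
have mF := mc_mono FM (ltW yx).
rewrite (ger0_norm (_ : 0 <= F x - F y)) ?subr_ge0//.
rewrite ler_norml /C; apply/andP.
have [wx|xw] := leP w x.
  rewrite (ger0_norm (_ : 0 <= x - w)) ?subr_ge0//; split; nra.
by rewrite (ltr0_norm (_ : x - w < 0)) ?subr_lt0//; split; nra.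
Qed.

(** M falls from 0 at -oo until w, then rises back to 0 at +oo. *)
Lemma moment_le0 x : M x <= 0.
Proof.
apply/ler_addgt0Pr => e e0; have [xw|wx] := leP x w.
  have [a Ha] := mc_M0 FM e0.
  have := Ha (Order.min a x); rewrite ge_min lexx => /(_ isT).
  have h := @moment_homo_left (Order.min a x) x; move: h.
  by rewrite ge_min lexx orbT => /(_ isT xw); rewrite ltr_norml; lra.
have [a Ha] := mc_M1 FM e0.
have := Ha (Order.max a x); rewrite le_max lexx => /(_ isT).
have h := @moment_homo_right x (Order.max a x); move: h.
by rewrite le_max lexx orbT => /(_ (ltW wx) isT); rewrite ltr_norml; lra.
Qed.

(** Take x so far left that F(x) < F(a) / 2: from x to a the moment falls by at least (w - a) F(a) /
    2, which outweighs the small M(x). *)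
Lemma moment_lt0_left a : a < w -> 0 < F a -> M a < 0.
Proof.
move=> aw Fa.
have [e [e0 he]] : exists e, 0 < e /\ e + (a - w) * (F a / 2) < 0.
  by exists ((w - a) * F a / 4); split; nra.
have F2 : 0 < F a / 2 by lra.
have [b Hb] := mc_F0 FM F2.
have [c Hc] := mc_M0 FM e0.
pose x := Order.min a (Order.min b c).
have xa : x <= a by rewrite /x ge_min lexx.
have := Hb x; rewrite /x !ge_min lexx orbT => /(_ isT).
have := Hc x; rewrite /x !ge_min lexx !orbT => /(_ isT).
rewrite -/x !ltr_norml => h1 h2.
have /andP[_ h] := mc_bound FM xa.
nra.
Qed.

Lemma moment_lt0_right b : w < b -> F b < 1 -> M b < 0.
Proof.
move=> wb Fb.
have [e [e0 he]] : exists e, 0 < e /\ e < (b - w) * ((1 - F b) / 2).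
  by exists ((b - w) * (1 - F b) / 4); split; nra.
have F2 : 0 < (1 - F b) / 2 by lra.
have [p Hp] := mc_F1 FM F2.
have [c Hc] := mc_M1 FM e0.
pose x := Order.max b (Order.max p c).
have xa : b <= x by rewrite /x le_max lexx.
have := Hp x; rewrite /x !le_max lexx orbT => /(_ isT).
have := Hc x; rewrite /x !le_max lexx !orbT => /(_ isT).
rewrite -/x !ltr_norml => h1 h2.
have /andP[h _] := mc_bound FM xa.
nra.
Qed.

Lemma mcdf_ge0 x : 0 <= F x.
Proof.
apply/ler_addgt0Pr => e e0.
have [a Ha] := mc_F0 FM e0.
have := Ha (Order.min a x); rewrite ge_min lexx => /(_ isT).
have : F (Order.min a x) <= F x by apply: (mc_mono FM); rewrite ge_min lexx orbT.
by rewrite ltr_norml; lra.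
Qed.

Lemma mcdf_le1 x : F x <= 1.
Proof.
apply/ler_addgt0Pr => e e0.
have [a Ha] := mc_F1 FM e0.
have := Ha (Order.max a x); rewrite le_max lexx => /(_ isT).
have : F x <= F (Order.max a x) by apply: (mc_mono FM); rewrite le_max lexx orbT.
by rewrite ltr_norml; lra.
Qed.

Lemma cdf_close x e : 0 < e -> exists2 d, 0 < d &
  forall y, `|x - y| < d -> `|F x - F y| < e.
Proof. by move: (mc_cont FM x) => /continuousP_dist; apply. Qed.

(** If M(w) = 0, then M vanishes everywhere, so F is 0 before w and 1 after it: a jump at w, against
    the continuity of F. *)
Lemma mean_moment_lt0 : M w < 0.
Proof.
rewrite lt_neqAle moment_le0 andbT; apply/eqP => M0.
have Mz x : M x = 0.
  apply/eqP; rewrite eq_le moment_le0/= -M0.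
  have [xw|/ltW wx] := leP x w; first exact: moment_homo_left.
  exact: moment_homo_right.
have Fl x : x < w -> F x = 0.
  move=> xw; apply/eqP; rewrite eq_le mcdf_ge0 andbT leNgt.
  by apply/negP => /(moment_lt0_left xw); rewrite Mz ltxx.
have Fr x : w < x -> F x = 1.
  move=> xw; apply/eqP; rewrite eq_le mcdf_le1 /= leNgt.
  by apply/negP => /(moment_lt0_right xw); rewrite Mz ltxx.
have [d d0 Hd] := @cdf_close w (1/2) ltac:(lra).
have := Hd (w - d / 2); have := Hd (w + d / 2).
rewrite (Fl (w - d / 2)) ?(Fr (w + d / 2)); [|lra|lra].
rewrite !ltr_norml => h1 h2.
have := h1 ltac:(lra); have := h2 ltac:(lra); lra.
Qed.

(** Without mass left of w, M would be constant there, and M(w) would equal its limit 0 at -oo. *)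
Lemma cdf_mean_gt0 : 0 < F w.
Proof.
rewrite lt_neqAle mcdf_ge0 andbT eq_sym; apply/eqP => Fw.
have Mw : 0 < - M w by rewrite oppr_gt0 mean_moment_lt0.
have [a Ha] := mc_M0 FM Mw.
have := Ha (Order.min a w); rewrite ge_min lexx => /(_ isT).
have xw : Order.min a w <= w by rewrite ge_min lexx orbT.
have /andP[h _] := mc_bound FM xw.
have hF := mc_mono FM xw; have := mcdf_ge0 (Order.min a w).
rewrite ltr_norml => h1 h2.
have F0 : F (Order.min a w) = 0 by lra.
rewrite Fw F0 in h; lra.
Qed.

Lemma cdf_mean_lt1 : F w < 1.
Proof.
rewrite lt_neqAle mcdf_le1 andbT; apply/eqP => Fw.
have Mw : 0 < - M w by rewrite oppr_gt0 mean_moment_lt0.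
have [a Ha] := mc_M1 FM Mw.
have := Ha (Order.max a w); rewrite le_max lexx => /(_ isT).
have xw : w <= Order.max a w by rewrite le_max lexx orbT.
have /andP[_ h] := mc_bound FM xw.
have hF := mc_mono FM xw; have := mcdf_le1 (Order.max a w).
rewrite ltr_norml => h1 h2.
have F0 : F (Order.max a w) = 1 by lra.
rewrite Fw F0 in h; lra.
Qed.

Lemma cdf_value v : 0 < v < 1 -> exists x, F x = v.
Proof.
move=> /andP[v0 v1].
have [a Ha] := mc_F0 FM v0.
have hb : 0 < 1 - v by lra.
have [b Hb] := mc_F1 FM hb.
pose b' := Order.max a b.
have ab' : a <= b' by rewrite /b' le_max lexx.
have hFa := Ha _ (lexx a).
have bb' : b <= b' by rewrite /b' le_max lexx orbT.
have hFb := Hb _ bb'.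
have hab := mc_mono FM ab'.
have [c _ Hc] := @IVT R F a b' v ab' (continuous_subspaceT (mc_cont FM))
  ltac:(rewrite minEle maxEle hab; move: hFa hFb; rewrite !ltr_norml; lra).
by exists c.
Qed.

(* The intervals [r, r + t] with r <= w <= r + t and equal moments at both
   ends are parametrized by their width t; the left end r is then monotone in t
   and so is r + t, which makes the path 1-Lipschitz even where nu has gaps. *)
Definition left_candidates (t : R) : set R :=
  [set r | w - t <= r <= w /\ M (r + t) <= M r].

(** On [w - t, w] the map r -> M(r + t) - M(r) is nondecreasing, so the candidates form an interval
    and the supremum is the rightmost root. Negative widths are cut to 0, which makes the path
    continuous on the whole line. *)
Definition left_path (t : R) : R := sup (left_candidates (Num.max t 0)).

Definition right_path (t : R) : R := left_path t + Num.max t 0.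

Lemma left_candidates_start t : 0 <= t -> left_candidates t (w - t).
Proof.
move=> t0; split; first by apply/andP; split; lra.
by rewrite subrK; apply: moment_homo_left; lra.
Qed.

Lemma left_candidates_has_sup t : 0 <= t -> has_sup (left_candidates t).
Proof.
move=> t0; split; first by exists (w - t); exact: left_candidates_start.
by exists w => r [/andP[]].
Qed.

Let mx0 (t : R) : 0 <= Num.max t 0. Proof. by rewrite le_max lexx orbT. Qed.

Lemma left_path_itv t : w - Num.max t 0 <= left_path t <= w.
Proof.
have hs := left_candidates_has_sup (mx0 t).
apply/andP; split.
  exact: (sup_upper_bound hs) (left_candidates_start (mx0 t)).
by apply: (ge_sup hs.1) => r [/andP[]].
Qed.

(** A left end admissible for the larger width either lies left of w - t or stays admissible for t,
    since shrinking the interval from the right lowers M at its right end. *)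
Lemma left_path_nonincreasing t t' : t <= t' -> left_path t' <= left_path t.
Proof.
move=> tt'; have hm : Num.max t 0 <= Num.max t' 0.
  by rewrite ge_max mx0 le_max tt'.
apply: (ge_sup (left_candidates_has_sup (mx0 t')).1) => r [/andP[r1 r2] r3].
have [rt|tr] := leP r (w - Num.max t 0).
  by apply: (le_trans rt); have /andP[] := left_path_itv t.
apply: (sup_upper_bound (left_candidates_has_sup (mx0 t))); split.
  by rewrite (ltW tr) r2.
by apply: le_trans r3; apply: moment_homo_right; lra.
Qed.

(** Widening an interval to the left only keeps its right end and raises M at its left end, so
    admissibility survives. *)
Lemma right_path_nondecreasing t t' : t <= t' -> right_path t <= right_path t'.
Proof.
move=> tt'; have hm : Num.max t 0 <= Num.max t' 0.
  by rewrite ge_max mx0 le_max tt'.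
rewrite /right_path -lerBrDr.
apply: (ge_sup (left_candidates_has_sup (mx0 t)).1) => r [/andP[r1 r2] r3].
set m := Num.max t 0 in hm r1 r3 *; set m' := Num.max t' 0 in hm *.
suff : r - (m' - m) <= left_path t' by lra.
apply: (sup_upper_bound (left_candidates_has_sup (mx0 t'))); rewrite -/m'; split.
  by apply/andP; split; lra.
have -> : r - (m' - m) + m' = r + m by ring.
by apply: (le_trans r3); apply: moment_homo_left; lra.
Qed.

Lemma max0_lip (t t' : R) : t <= t' -> Num.max t' 0 - Num.max t 0 <= t' - t.
Proof. by move=> tt'; rewrite !maxElt; case: ifP; case: ifP; lra. Qed.

Lemma left_path_continuous : continuous left_path.
Proof.
apply: lip1_continuous => t t' tt'.
have := left_path_nonincreasing tt'; have := right_path_nondecreasing tt'.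
have := max0_lip tt'; rewrite /right_path ler_norml; lra.
Qed.

Lemma right_path_continuous : continuous right_path.
Proof.
apply: lip1_continuous => t t' tt'.
have := left_path_nonincreasing tt'; have := right_path_nondecreasing tt'.
have := max0_lip tt'; rewrite /right_path ler_norml; lra.
Qed.

(** At the supremum r, a negative difference would leave room for a larger candidate (r = w is
    excluded, M being nondecreasing right of w); a positive one would keep all candidates away from
    r. *)
Lemma moment_path t : M (right_path t) = M (left_path t).
Proof.
rewrite /right_path; set m := Num.max t 0; set r := left_path t.
have m0 : 0 <= m := mx0 t.
have hs := left_candidates_has_sup m0.
have /andP[r1 r2] : w - m <= r <= w := left_path_itv t.
pose h x := M (x + m) - M x.
have hcont : {for r, continuous h}.
  apply: (@continuousB _ _ _ (fun x => M (x + m)) M); last exact: moment_continuous.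
  apply: (@continuous_comp _ _ _ (fun x => x + m) M); last exact: moment_continuous.
  by apply: cvgD; [exact: cvg_id|exact: cvg_cst].
apply/eqP; rewrite -subr_eq0 -/(h r); apply/eqP.
have [hr|hr|//] := ltgtP (h r) 0.
  have rw : r < w.
    rewrite lt_neqAle r2 andbT; apply/eqP => rw; move: hr; rewrite /h rw subr_lt0.
    by rewrite ltNge moment_homo_right// lerDl.
  have : - h r > 0 by rewrite oppr_gt0.
  move: (proj1 (continuousP_dist _ _) hcont) => /[apply] -[d d0 Hd].
  pose x := r + Num.min (d / 2) (w - r).
  have rx : r < x by rewrite /x ltrDl lt_min; apply/andP; split; lra.
  have xw : x <= w by rewrite /x -lerBrDl ge_min lexx orbT.
  have xd : x <= r + d / 2 by rewrite /x lerD2l ge_min lexx.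
  have : `|h r - h x| < - h r.
    by apply: Hd; rewrite ltr_norml; apply/andP; split; lra.
  rewrite ltr_norml => /andP[hx _].
  have : left_candidates m x.
    split; first by apply/andP; split; lra.
    have : h x < 0 by lra.
    by rewrite /h; lra.
  by move/(sup_upper_bound hs) => /=; rewrite -/(left_path t) -/r; lra.
have [d d0 Hd] := proj1 (continuousP_dist _ _) hcont _ hr.
have [x [/andP[x1 x2] x3] xs] := sup_adherent d0 hs.
have xr : x <= r by apply: (sup_upper_bound hs); split; rewrite ?x1.
have xs' : r - d < x by exact: xs.
have : `|h r - h x| < h r.
  by apply: Hd; rewrite ltr_norml; apply/andP; split; lra.
rewrite ltr_norml => /andP[_ hx].
have : 0 < h x by lra.
by rewrite /h; lra.
Qed.

Lemma path_reaches a b : a < w -> w < b -> M a < 0 -> M b < 0 ->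
  exists t, left_path t <= a /\ b <= right_path t.
Proof.
move=> aw wb Ma Mb.
have Ma' : 0 < - M a by lra.
have Mb' : 0 < - M b by lra.
have [x0 Hx0] := mc_M0 FM Mb'.
have [x1 Hx1] := mc_M1 FM Ma'.
(* If the left end stayed right of a, the right end would exceed x1, where M > M(a), against the
   equality of moments; b - x0 serves the right end likewise. *)
pose t := Num.max 0 (Num.max (b - x0) (x1 - a)).
have t0 : 0 <= t by rewrite /t le_max lexx.
have tb : b - x0 <= t by rewrite /t !le_max lexx !orbT.
have ta : x1 - a <= t by rewrite /t !le_max lexx !orbT.
have mt : Num.max t 0 = t by exact: max_l.
have E := moment_path t.
have /andP[l1 l2] := left_path_itv t.
have R1 : right_path t = left_path t + t by rewrite /right_path mt.
have wR : w <= right_path t by rewrite R1; rewrite mt in l1; lra.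
exists t; split; rewrite leNgt; apply/negP => H.
  have h := Hx1 (right_path t) ltac:(lra).
  have := moment_homo_left (ltW H) l2.
  by move: h; rewrite ltr_norml; lra.
have h := Hx0 (left_path t) ltac:(lra).
have := moment_homo_right wR (ltW H).
by move: h; rewrite ltr_norml; lra.
Qed.

Lemma path_mass u : 0 < u < 1 -> exists t, F (right_path t) - F (left_path t) = u.
Proof.
move=> /andP[u0 u1].
have := cdf_mean_gt0; have := cdf_mean_lt1 => Fw1 Fw0.
(* The quantiles a and b of levels e and 1 - e must lie on the two sides of w, and [a, b] must have
   mass 1 - 2 e >= u. *)
pose e := Num.min (F w / 2) (Num.min ((1 - F w) / 2) ((1 - u) / 2)).
have e0 : 0 < e by rewrite /e !lt_min; apply/and3P; split; lra.
have e1 : e <= F w / 2 by rewrite /e ge_min lexx.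
have e2 : e <= (1 - F w) / 2 by rewrite /e !ge_min lexx !orbT.
have e3 : e <= (1 - u) / 2 by rewrite /e !ge_min lexx !orbT.
have [a Fa] := @cdf_value e ltac:(lra).
have [b Fb] := @cdf_value (1 - e) ltac:(lra).
have aw : a < w.
  by rewrite ltNge; apply/negP => /(mc_mono FM); lra.
have wb : w < b.
  by rewrite ltNge; apply/negP => /(mc_mono FM); lra.
have [t [ta tb]] := path_reaches aw wb (moment_lt0_left aw ltac:(lra))
  (moment_lt0_right wb ltac:(lra)).
have := mc_mono FM ta; have := mc_mono FM tb => Ftb Fta.
have w0 : left_path 0 = w.
  have := left_path_itv 0; rewrite maxxx subr0 => h.
  by apply/eqP; rewrite eq_le; case/andP: h => -> ->.
have t0 : 0 <= t.
  rewrite leNgt; apply/negP => /ltW /left_path_nonincreasing; rewrite w0; lra.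
pose f t := F (right_path t) - F (left_path t).
have fc : continuous f.
  move=> x; apply: (@continuousB _ _ _ (F \o right_path) (F \o left_path)).
    by apply: continuous_comp; [exact: right_path_continuous|exact: (mc_cont FM)].
  by apply: continuous_comp; [exact: left_path_continuous|exact: (mc_cont FM)].
have f0 : f 0 = 0 by rewrite /f /right_path maxxx addr0 subrr.
have ft : u <= f t by rewrite /f; lra.
have [c _ Hc] := @IVT R f 0 t u t0 (continuous_subspaceT fc)
  ltac:(rewrite minEle maxEle f0; case: ifP; lra).
by exists c.
Qed.

Lemma path_intervals : exists lo hi : R -> R,
  [/\ {in `]0, 1[ &, {homo lo : u v /~ u <= v}},
      {in `]0, 1[ &, {homo hi : u v / u <= v}} &
      {in `]0, 1[, forall u, [/\ lo u <= w <= hi u, F (hi u) - F (lo u) = u &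
        M (hi u) = M (lo u)]}].
Proof.
pose T u := if pselect (0 < u < 1) is left h then projT1 (cid (path_mass h)) else 0.
have TE u : 0 < u < 1 -> F (right_path (T u)) - F (left_path (T u)) = u.
  by move=> h; rewrite /T; case: pselect => // h'; case: cid.
(* The widths are picked by choice, but a larger width carries at least as much mass, so distinct
   masses force the order of the widths. *)
have Tmono u v : 0 < u < 1 -> 0 < v < 1 -> u <= v -> u = v \/ T u <= T v.
  move=> hu hv uv; have [|tv] := leP (T u) (T v); [by right|left].
  have := mc_mono FM (left_path_nonincreasing (ltW tv)).
  have := mc_mono FM (right_path_nondecreasing (ltW tv)).
  have := TE _ hu; have := TE _ hv; lra.
exists (left_path \o T), (right_path \o T); split.
- move=> v u; rewrite !in_itv/= => hv hu uv.
  have [->//|h] := Tmono _ _ hu hv uv; exact: left_path_nonincreasing.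
- move=> u v; rewrite !in_itv/= => hu hv uv.
  have [->//|h] := Tmono _ _ hu hv uv; exact: right_path_nondecreasing.
- move=> u; rewrite in_itv/= => hu; split => /=; [|exact: TE|exact: moment_path].
  have := left_path_itv (T u); rewrite /right_path; lra.
Qed.

(** * Properties shared by all families of balanced intervals *)

Section Intervals.
Context (lo hi : R -> R)
  (lo_mono : {in `]0, 1[ &, {homo lo : u v /~ u <= v}})
  (hi_mono : {in `]0, 1[ &, {homo hi : u v / u <= v}})
  (lohi : {in `]0, 1[, forall u, [/\ lo u <= w <= hi u, F (hi u) - F (lo u) = u &
        M (hi u) = M (lo u)]}).

(** If [lo u = w], then [w, hi u] has mass u and zero moment about w. Continuity of F keeps part of
    this mass at a positive distance from w, which makes the moment positive. *)
Lemma interval_lo_lt u : 0 < u < 1 -> lo u < w.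
Proof.
move=> hu; have := lohi; move=> /(_ u); rewrite in_itv/= => /(_ hu).
move=> [/andP[lw wh] Fu Mu].
rewrite lt_neqAle lw andbT; apply/eqP => lE; rewrite lE in Fu Mu.
have [d d0 Hd] := @cdf_close w u ltac:(lra).
have wh' : w < hi u.
  by rewrite lt_neqAle wh andbT; apply/eqP => wE; move: Fu; rewrite -wE; lra.
pose x := Num.min (hi u) (w + d / 2).
have wx : w < x by rewrite /x lt_min wh'/=; lra.
have xd : x <= w + d / 2 by rewrite /x ge_min lexx orbT.
have xh : x <= hi u by rewrite /x ge_min lexx.
have := Hd x; rewrite !ltr_norml => /(_ ltac:(lra)) h.
have := moment_homo_right (lexx w) (ltW wx).
have /andP[h1 _] := mc_bound FM xh.
nra.
Qed.

Lemma interval_hi_gt u : 0 < u < 1 -> w < hi u.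
Proof.
move=> hu; have := lohi; move=> /(_ u); rewrite in_itv/= => /(_ hu).
move=> [/andP[lw wh] Fu Mu].
rewrite lt_neqAle wh andbT; apply/eqP => lE; rewrite -lE in Fu Mu.
have [d d0 Hd] := @cdf_close w u ltac:(lra).
have wh' := interval_lo_lt hu.
pose x := Num.max (lo u) (w - d / 2).
have wx : x < w by rewrite /x gt_max wh'/=; lra.
have xd : w - d / 2 <= x by rewrite /x le_max lexx orbT.
have xh : lo u <= x by rewrite /x le_max lexx.
have := Hd x; rewrite !ltr_norml => /(_ ltac:(lra)) h.
have := moment_homo_left (ltW wx) (lexx w).
have /andP[_ h1] := mc_bound FM xh.
nra.
Qed.

(** The shell between the two intervals splits into a left part of mass p and a right part of mass q
    with p + q = v - u and opposite moments. The left moment lies between (w - lo u) p and (w - lo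
    v) p in size, the right one between (hi u - w) q and (hi v - w) q. *)
Lemma interval_mass_bounds u v : 0 < u -> u < v -> v < 1 ->
  (v - u) * ((hi u - w) / (hi u - lo v)) <= F (lo u) - F (lo v)
    <= (v - u) * ((hi v - w) / (hi v - lo u)).
Proof.
move=> u0 uv v1.
have hu : 0 < u < 1 by lra.
have hv : 0 < v < 1 by lra.
have iu : u \in `]0, 1[ by rewrite in_itv.
have iv : v \in `]0, 1[ by rewrite in_itv.
have [_ Fu Mu] := lohi iu; have [_ Fv Mv] := lohi iv.
have lu := interval_lo_lt hu; have lv := interval_lo_lt hv.
have hiu := interval_hi_gt hu; have hiv := interval_hi_gt hv.
have ll := lo_mono iv iu (ltW uv); have hh := hi_mono iu iv (ltW uv).
have /andP[a1 a2] := mc_bound FM ll; have /andP[b1 b2] := mc_bound FM hh.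
rewrite !mulrA ler_pdivrMr ?ler_pdivlMr; [|lra|lra].
by apply/andP; split; nra.
Qed.

End Intervals.
End MomentCdfTheory.

(** * The distribution function of an atomless law *)

(** Dominated convergence on {n <= |z|}, uniform over the sets A contained in it. With f = 1 and f =
    z - w it gives the limits of F and M at both infinities. *)
Lemma integral_tail_cvg (R : realType) (nu : probability (measurableTypeR R) R) (f : R -> R)
    (fi : nu.-integrable setT (EFin \o f)) (e : R) : 0 < e ->
  exists N : R, forall A : set (measurableTypeR R), measurable A ->
    (forall z, A z -> N <= `|z|) -> `|\int[nu]_(z in A) f z| < e.
Proof.
move=> e0.
pose T (n : nat) : set (measurableTypeR R) := [set z | n%:R <= `|z|].
have mT n : measurable (T n).
  have -> : T n = ~` `]- n%:R, n%:R[%classic.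
    by apply/seteqP; split => z; rewrite /T/= in_itv/= -ltr_norml leNgt => /negP.
  exact: measurableC.
pose g n := (fun z => `|f z|%:E) \_ (T n).
have mf : measurable_fun setT f.
  by have := measurable_int nu fi; move/measurable_EFinP.
have fa : nu.-integrable setT (fun z => `|f z|%:E) by exact: (integrable_abse fi).
have mg n : measurable_fun setT (g n).
  by apply/(measurable_restrictT _ (mT n))/measurable_funTS/measurable_EFinP; exact: measurableT_comp.
have g0 : {ae nu, forall z, setT z -> g ^~ z @ \oo --> cst 0%E z}.
  apply/aeW => z _; apply: cvg_near_cst.
  have Hn : `|z| < (Num.bound `|z|)%:R by exact: archi_boundP.
  exists (Num.bound `|z|) => // k /= nk.
  rewrite /g patchE ifF//; apply/negbTE; rewrite notin_setE /T/=; apply/negP.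
  by rewrite -ltNge (lt_le_trans Hn)// ler_nat.
have gf : {ae nu, forall z n, setT z -> `|g n z| <= `|f z|%:E}%E.
  apply/aeW => z n _; rewrite /g patchE; case: ifP => _; rewrite ?abse0 ?lee_fin//=.
  by rewrite normr_id.
have [_ _] := @dominated_convergence _ (measurableTypeR R) R nu setT measurableT g
  (cst 0%E) (fun z => `|f z|%:E) mg (measurable_cst _) g0 fa gf.
rewrite integral0 => /fine_cvgP[_ /cvgrPdist_lt/(_ _ e0)[n _ Hn]].
exists n%:R => A mA AN.
have {Hn} := Hn n (leqnn n); rewrite /= sub0r normrN; apply: le_lt_trans.
have fiA : nu.-integrable A (EFin \o f) by exact: integrableS fi.
apply: (le_trans (@le_normr_Rintegral _ (measurableTypeR R) R nu A f mA fiA)).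
rewrite /g -integral_mkcond; apply: le_trans (ler_norm _).
have AT : A `<=` T n by move=> z /AN.
have faT : nu.-integrable (T n) (fun z => `|f z|%:E) by exact: integrableS fa.
rewrite fine_le//.
- by apply: integrable_fin_num => //; apply: integrableS fa.
- exact: integrable_fin_num.
- apply: ge0_subset_integral => //; exact: (measurable_int nu).
Qed.

Section LawCdf.
Context (R : realType) (nu : probability (measurableTypeR R) R) (w : R)
  (nu_atomless : atomless nu)
  (nu_integrable : nu.-integrable setT (EFin \o id : R -> \bar R))
  (nu_mean : (\int[nu]_x x%:E = w%:E)%E).

Definition lcdf (x : R) : R := fine (nu `]-oo, x]%classic).

Definition lmoment (x : R) : R := \int[nu]_(z in `]-oo, x]) (z - w).

Lemma integrable_centered : nu.-integrable setT (fun z : R => (z - w)%:E).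
Proof.
have -> : (fun z : R => (z - w)%:E) = ((EFin \o id) \- (EFin \o cst w))%E by [].
by apply: integrableB => //; exact: finite_measure_integrable_cst.
Qed.

Lemma integral_centered : \int[nu]_z (z - w) = 0.
Proof.
rewrite RintegralB//; last exact: finite_measure_integrable_cst.
rewrite Rintegral_cst//= probability_setT /= mulr1 /Rintegral.
by rewrite nu_mean /= subrr.
Qed.

Lemma itv_split (x y : R) : x <= y -> `]-oo, y]%classic = `]-oo, x] `|` `]x, y].
Proof.
move=> xy; apply/seteqP; split => z /=; rewrite !in_itv/=.
  by have [zx|xz] := leP z x; [left|right].
by case => [zx|/andP[]//]; exact: le_trans xy.
Qed.

Lemma itv_split_disj (x y : R) : [disjoint `]-oo, x]%classic & `]x, y]%classic].
Proof.
apply/disj_setPS => z [] /=; rewrite !in_itv/= => zx /andP[xz _].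
by move: zx; rewrite leNgt xz.
Qed.

Lemma lcdf_itv_oc x y : x <= y -> nu `]x, y]%classic = (lcdf y - lcdf x)%:E.
Proof.
move=> xy; rewrite EFinB /lcdf !fineK ?fin_num_measure//.
rewrite (itv_split xy) measureU//; last first.
  by apply/disj_set2P; exact: itv_split_disj.
by rewrite addeAC subee ?add0e// fin_num_measure.
Qed.

Lemma lcdf_mono : {homo lcdf : x y / x <= y}.
Proof. by move=> x y xy; rewrite -subr_ge0 -lee_fin -lcdf_itv_oc. Qed.

Lemma lcdf_atom x : nu [set x] = 0%E.
Proof.
apply/eqP; rewrite eq_le measure_ge0 andbT; apply/lee_addgt0Pr => e e0.
have /continuousP_dist/(_ _ e0)[d d0 Hd] := @nu_atomless x.
have xd : x - d / 2 <= x by lra.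
apply: (@le_trans _ _ (nu `]x - d / 2, x]%classic)).
  by apply: le_measure; rewrite ?inE// => z -> /=; rewrite in_itv/=; lra.
rewrite lcdf_itv_oc// add0e lee_fin.
have := Hd (x - d / 2); rewrite opprB addrCA subrr addr0 => /(_ _).
rewrite ger0_norm; last lra.
move=> /(_ ltac:(lra)); rewrite -/(lcdf x) -/(lcdf (x - d / 2)) ltr_norml; lra.
Qed.

Lemma itv_ccE (x y : R) : x <= y -> `[x, y]%classic = [set x] `|` `]x, y].
Proof.
move=> xy; apply/seteqP; split => z /=; rewrite !in_itv/=.
  by move=> /andP[]; rewrite le_eqVlt => /predU1P[->|xz zy]; [left|right; rewrite xz].
by case=> [->|/andP[/ltW -> ->]//]; rewrite lexx.
Qed.

Lemma lcdf_itv_cc x y : x <= y -> nu `[x, y]%classic = (lcdf y - lcdf x)%:E.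
Proof.
move=> xy; rewrite (itv_ccE xy) measureU//.
  by rewrite [X in (X + _)%E]lcdf_atom add0e; exact: lcdf_itv_oc.
by apply/seteqP; split => z // -[/= ->]; rewrite in_itv/= ltxx.
Qed.

Let centered_integrable A : measurable A -> nu.-integrable A (EFin \o (fun z : R => z - w)).
Proof. by move=> mA; apply: integrableS integrable_centered. Qed.

Lemma lmoment_itv_oc x y : x <= y -> \int[nu]_(z in `]x, y]) (z - w) = lmoment y - lmoment x.
Proof.
move=> xy; rewrite /lmoment (itv_split xy) Rintegral_setU//; last exact: itv_split_disj.
  by rewrite addrAC subrr add0r.
by apply: centered_integrable; exact: measurableU.
Qed.

Lemma lmoment_itv_cc x y : x <= y ->
  (\int[nu]_(z in `[x, y]) (z - w)%:E = (lmoment y - lmoment x)%:E)%E.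
Proof.
move=> xy; rewrite -lmoment_itv_oc// /Rintegral fineK; last first.
  by apply: integrable_fin_num => //; exact: centered_integrable.
rewrite (itv_ccE xy) integral_setU//.
- rewrite (null_set_integral _ _ (lcdf_atom x)) ?add0e//.
  by apply: (measurable_int nu); exact: centered_integrable.
- apply: (measurable_int nu); apply: centered_integrable; exact: measurableU.
- by apply/disj_setPS => z [/= ->]; rewrite in_itv/= ltxx.
Qed.

Lemma lmoment_bound x y : x <= y ->
  (x - w) * (lcdf y - lcdf x) <= lmoment y - lmoment x <= (y - w) * (lcdf y - lcdf x).
Proof.
move=> xy; rewrite -lmoment_itv_oc//.
have -> : lcdf y - lcdf x = fine (nu `]x, y]%classic) by rewrite lcdf_itv_oc.
rewrite -!Rintegral_cst//; apply/andP; split; apply: le_Rintegral => //;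
  try exact: centered_integrable; try exact: finite_measure_integrable_cst.
- by move=> z /=; rewrite in_itv/= => /andP[]; lra.
- by move=> z /=; rewrite in_itv/= => /andP[]; lra.
Qed.

Lemma lcdf_compl x : 1 - lcdf x = \int[nu]_(z in `]x, +oo[) 1.
Proof.
rewrite Rintegral_cst// mul1r.
transitivity (fine (nu (~` `]-oo, x]%classic))).
  by rewrite probability_setC// fineB ?fin_num_measure.
by congr (fine (nu _)); rewrite setCitvl.
Qed.

(** Since the mean is w, the total moment vanishes and M is minus a right tail; hence it tends to 0
    at +oo as well. *)
Lemma lmoment_compl x : - lmoment x = \int[nu]_(z in `]x, +oo[) (z - w).
Proof.
have := integral_centered; have -> : [set: R] = `]-oo, x] `|` `]x, +oo[.
  by rewrite -setCitvl setUv.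
rewrite Rintegral_setU//.
- by rewrite -/(lmoment x) => h; lra.
- by apply: centered_integrable; exact: measurableU.
- by rewrite -setCitvl; apply/disj_setPS => z [].
Qed.

Lemma law_moment_cdf : moment_cdf w lcdf lmoment.
Proof.
have one : nu.-integrable setT (EFin \o (fun _ : R => 1 : R)).
  exact: finite_measure_integrable_cst.
have F1 x : lcdf x = \int[nu]_(z in `]-oo, x]) 1 by rewrite Rintegral_cst// mul1r.
split.
- exact: lcdf_mono.
- exact: nu_atomless.
- exact: lmoment_bound.
- move=> e /(integral_tail_cvg one)[N HN]; exists (- N) => x xN; rewrite F1.
  by apply: HN => // z; rewrite /= in_itv/= => zx; rewrite -normrN (le_trans _ (ler_norm _)); lra.
- move=> e /(integral_tail_cvg one)[N HN]; exists N => x xN; rewrite lcdf_compl.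
  apply: HN => // z; rewrite /= in_itv/= andbT => zx.
  by rewrite (le_trans _ (ler_norm _))//; lra.
- move=> e /(integral_tail_cvg integrable_centered)[N HN]; exists (- N) => x xN.
  by apply: HN => // z; rewrite /= in_itv/= => zx; rewrite -normrN (le_trans _ (ler_norm _)); lra.
- move=> e /(integral_tail_cvg integrable_centered)[N HN]; exists N => x xN.
  rewrite -normrN lmoment_compl.
  apply: HN => // z; rewrite /= in_itv/= andbT => zx.
  by rewrite (le_trans _ (ler_norm _))//; lra.
Qed.

(** Without atoms, closed and half-open intervals have equal mass and moment, so the conditions on R
    and S become equations in F and M. *)
Lemma barycentric_cdf lo hi : barycentric_intervals nu w lo hi <->
  [/\ {in `]0, 1[ &, {homo lo : u v /~ u <= v}},
      {in `]0, 1[ &, {homo hi : u v / u <= v}} &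
      {in `]0, 1[, forall u, [/\ lo u <= w <= hi u, lcdf (hi u) - lcdf (lo u) = u &
        lmoment (hi u) = lmoment (lo u)]}].
Proof.
split=> -[hlo hhi H]; split => // u hu; have [lw h1 h2] := H u hu; split => //;
  have luhu : lo u <= hi u by case/andP: lw; exact: le_trans.
- by apply/EFin_inj; rewrite -lcdf_itv_cc.
- by apply/eqP; rewrite -subr_eq0; apply/eqP/EFin_inj; rewrite -lmoment_itv_cc.
- by rewrite lcdf_itv_cc ?h1.
- by rewrite lmoment_itv_cc ?h2 ?subrr.
Qed.

Lemma barycentric_intervals_exist : exists lo hi : R -> R, barycentric_intervals nu w lo hi.
Proof.
have [lo [hi H]] := path_intervals law_moment_cdf.
by exists lo, hi; apply/barycentric_cdf.
Qed.

End LawCdf.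

(** * Probability preliminaries *)

(* Summing over n equal steps shows |D b - D a| <= C (b - a) (T b - T a) / n for every n. *)
Lemma eq_of_small_increments (R : realType) (D T : R -> R) (a b C : R) : a <= b ->
  (forall u v, a <= u -> u < v -> v <= b ->
    `|D v - D u| <= C * (v - u) * (T v - T u)) -> D a = D b.
Proof.
rewrite le_eqVlt => /predU1P[->//|ab] H.
have step (n i : nat) (h := (b - a) / n.+1%:R) : (i <= n.+1)%N ->
    `|D (a + i%:R * h) - D a| <= C * h * (T (a + i%:R * h) - T a).
  have n0 : 0 < n.+1%:R :> R by rewrite ltr0n.
  have h0 : 0 < h by rewrite /h divr_gt0// subr_gt0.
  have hn : n.+1%:R * h = b - a by rewrite /h mulrC divfK// gt_eqF.
  elim: i => [_|i IH iLn]; first by rewrite mul0r addr0 !subrr normr0 mulr0.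
  have {}IH := IH (ltnW iLn).
  have ih : 0 <= i%:R * h by rewrite mulr_ge0// ?ler0n// ltW.
  have iS : i.+1%:R * h = i%:R * h + h by rewrite -natr1 mulrDl mul1r.
  have iLn' : i.+1%:R * h <= b - a by rewrite -hn ler_pM2r// ler_nat.
  set x := a + i%:R * h in IH *; set y := a + i.+1%:R * h.
  have yx : y - x = h by rewrite /x /y iS; ring.
  have := H x y; rewrite yx => /(_ _ _ _)K.
  have {}K := K ltac:(rewrite /x; lra) ltac:(lra) ltac:(rewrite /y; lra).
  have tri : `|D y - D a| <= `|D y - D x| + `|D x - D a|.
    by rewrite -(subrKA (D x)); exact: ler_normD.
  apply: (le_trans tri).
  have -> : C * h * (T y - T a) = C * h * (T y - T x) + C * h * (T x - T a) by ring.
  exact: lerD.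
pose K := C * (b - a) * (T b - T a).
have main (n : nat) : `|D b - D a| * n.+1%:R <= K.
  have := step n n.+1 (leqnn _) => /=.
  have n0 : n.+1%:R != 0 :> R by rewrite pnatr_eq0.
  have -> : a + n.+1%:R * ((b - a) / n.+1%:R) = b by rewrite mulrC divfK// addrC subrK.
  rewrite (_ : C * ((b - a) / n.+1%:R) * (T b - T a) = K / n.+1%:R); last first.
    by rewrite /K; field.
  by rewrite ler_pdivlMr// ltr0n.
apply/eqP; rewrite eq_sym -subr_eq0 -normr_le0 leNgt; apply/negP => d0.
pose n := Num.bound (`|K| / `|D b - D a|).
have : `|K| / `|D b - D a| < n%:R by apply: archi_boundP; rewrite divr_ge0.
rewrite ltr_pdivrMr// => Kn.
have := main n; have := ler_norm K; rewrite -natr1 mulrDr mulr1; lra.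
Qed.

(** Let s be the supremum of the points outside I. A point v outside I just below s has c <= Phi v,
    the point s + e is in I and has Phi (s + e) <= f, and Phi drops by at most s + e - v in between.
    The bounds c <= Phi u + u and Phi u <= 1 - u settle s = 0 and s = 1. For the law of X_2, I is
    the set of u whose interval end has reached x, a value that it may jump over. *)
Lemma sandwich_le (R : realType) (I : set R) (Phi : R -> R) (c f : R) :
  0 <= f ->
  (forall u, 0 < u < 1 -> I u -> Phi u <= f) ->
  (forall u, 0 < u < 1 -> ~ I u -> c <= Phi u) ->
  (forall u, 0 < u < 1 -> c <= Phi u + u) ->
  (forall u, 0 < u < 1 -> Phi u <= 1 - u) ->
  (forall u v, 0 < u -> u < v -> v < 1 -> Phi u - Phi v <= v - u) ->
  c <= f.
Proof.
move=> f0 HI HnI Hc HPhi Hlip; apply/ler_addgt0Pr => e0 e00.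
(* The argument loses 2 e, whence e0 / 2; the bound 1 / 4 keeps v away from the point 0 added to S
   when sup S + e reaches 1. *)
pose e := Num.min (e0 / 2) (1 / 4).
have ep : 0 < e by rewrite /e lt_min; apply/andP; split; lra.
have e1 : e <= e0 / 2 by rewrite /e ge_min lexx.
have e2 : e <= 1 / 4 by rewrite /e ge_min lexx orbT.
pose S : set R := [set u | u = 0 \/ 0 < u < 1 /\ ~ I u].
have hs : has_sup S.
  split; first by exists 0; left.
  by exists 1 => u [->|[/andP[_ /ltW]]].
have [v Sv sv] := sup_adherent ep hs.
have s0 : 0 <= sup S by apply: (sup_upper_bound hs); left.
have vs : v <= sup S by exact: (sup_upper_bound hs).
have [s1|s1] := leP 1 (sup S + e).
  case: Sv => [v0|[v01 nIv]]; first by lra.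
  by have := HnI _ v01 nIv; have := HPhi _ v01; lra.
have u01 : 0 < sup S + e < 1 by lra.
have Iu : I (sup S + e).
  apply: contrapT => nI; have : S (sup S + e) by right.
  by move/(sup_upper_bound hs) => /=; lra.
have hu := HI _ u01 Iu.
case: Sv => [v0|[/andP[v0 v1] nIv]]; first by have := Hc _ u01; lra.
have cv := HnI v (introT andP (conj v0 v1)) nIv.
have svv : v < sup S + e by lra.
have su1 : sup S + e < 1 by lra.
have := Hlip _ _ v0 svv su1; lra.
Qed.

Section FineProbability.
Context d (T : measurableType d) (R : realType) (P : probability T R).
Implicit Types A B : set T.

Lemma fine_prob_ge0 A : 0 <= fine (P A).
Proof. by rewrite fine_ge0. Qed.

Lemma le_fine_prob A B : measurable A -> measurable B -> A `<=` B ->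
  fine (P A) <= fine (P B).
Proof.
by move=> mA mB AB; rewrite fine_le ?fin_num_measure//; apply: le_measure; rewrite ?inE.
Qed.

Lemma fine_probU A B : measurable A -> measurable B -> A `&` B = set0 ->
  fine (P (A `|` B)) = fine (P A) + fine (P B).
Proof. by move=> mA mB AB; rewrite measureU// fineD ?fin_num_measure. Qed.

Lemma le_fine_probU A B C : measurable A -> measurable B -> measurable C ->
  A `<=` B `|` C -> fine (P A) <= fine (P B) + fine (P C).
Proof.
move=> mA mB mC AB; apply: (@le_trans _ _ (fine (P (B `|` C)))).
  by apply: le_fine_prob => //; exact: measurableU.
have -> : B `|` C = B `|` (C `\` B).
  by rewrite setDE setUIr setUCr setIT.
rewrite fine_probU//; last by rewrite setDE setICA setICr setI0.
  by rewrite lerD2l; apply: le_fine_prob => //; exact: measurableD.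
exact: measurableD.
Qed.

Lemma fine_probC A : measurable A -> fine (P (~` A)) = 1 - fine (P A).
Proof. by move=> mA; rewrite probability_setC// fineB ?fin_num_measure. Qed.

End FineProbability.

(** * The uniform law on the unit square *)

Section UniformSquare.
Context (R : realType).
Notation T := (measurableTypeR R).
Notation P := (uniform_square R).

Lemma uniform01E (A : set T) : measurable A ->
  uniform01 R A = lebesgue_measure (A `&` `[0, 1]%classic).
Proof.
move=> mA; rewrite /uniform01 [LHS]integral_uniform_pdf.
rewrite (eq_integral (cst 1%E)); last first.
  move=> x; rewrite inE => -[_ /=]; rewrite in_itv/= => x01.
  by rewrite /uniform_pdf x01 subr0 invr1.
by rewrite integral_cst ?mul1e//; exact: measurableI.
Qed.

Lemma uniform01_oc a b : 0 <= a -> a <= b -> b <= 1 ->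
  uniform01 R `]a, b]%classic = (b - a)%:E.
Proof.
move=> a0 ab b1; rewrite uniform01E// setIidl; last first.
  by move=> x /=; rewrite !in_itv/=; lra.
rewrite lebesgue_measure_itv/= lte_fin.
by move: ab; rewrite le_eqVlt => /predU1P[->|->//]; rewrite ltxx subrr.
Qed.

Lemma uniform01_oo a b : 0 <= a -> a <= b -> b <= 1 ->
  uniform01 R `]a, b[%classic = (b - a)%:E.
Proof.
move=> a0 ab b1; rewrite uniform01E// setIidl; last first.
  by move=> x /=; rewrite !in_itv/=; lra.
rewrite lebesgue_measure_itv/= lte_fin.
by move: ab; rewrite le_eqVlt => /predU1P[->|->//]; rewrite ltxx subrr.
Qed.

Lemma uniform01_Nyc b : 0 <= b <= 1 -> uniform01 R `]-oo, b]%classic = b%:E.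
Proof.
move=> /andP[b0 b1]; rewrite uniform01E//.
have -> : `]-oo, b]%classic `&` `[0, 1]%classic = `[0, b]%classic.
  by apply/seteqP; split => x /=; rewrite !in_itv/=; lra.
rewrite lebesgue_measure_itv/= lte_fin.
by move: b0; rewrite le_eqVlt => /predU1P[<-|->]; rewrite ?ltxx// sube0.
Qed.

Lemma uniform_square_rect (A B : set T) (a b : R) : measurable A -> measurable B ->
  uniform01 R A = a%:E -> uniform01 R B = b%:E -> fine (P (A `*` B)) = a * b.
Proof.
move=> mA mB hA hB.
have h : P (A `*` B) = (uniform01 R A * uniform01 R B)%E.
  exact: (@product_measure1E _ _ T T R (uniform01 R) (uniform01 R)).
by rewrite h hA hB.
Qed.

(** Preimages of half-lines under a monotone function are intervals. Outside ]0, 1[, where nothing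
    is known of f, a constant replaces it. *)
Lemma measurable_homo_itv (f : R -> R) (c : R) :
  {in `]0, 1[ &, {homo f : u v / u <= v}} ->
  measurable_fun setT (fun u : T => if u \in `]0, 1[ then f u else c : T).
Proof.
move=> hf; apply: measurable_fun_if => //.
- by apply: (measurable_fun_bool true) => //; rewrite setTI; exact: measurable_itv.
- rewrite setTI.
  apply: (measurability (@RGenCInfty.G R)) => [|/= _ [_] [r] -> <-].
    exact: RGenCInfty.measurableE.
  apply: is_interval_measurable => s t /= [+ +] [+ +] u /andP[su ut].
  rewrite !in_itv/= !andbT => s01 rs t01 rt.
  have u01 : 0 < u < 1 by lra.
  split => //; apply: (le_trans rs); apply: hf => //; by rewrite in_itv.
Qed.

End UniformSquare.

(** * The terminal law of the interval model *)

(** Here s and r are the distances from w to the right and left ends, primed for the larger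
    interval, and k is a lower bound for the widths. The gap between the two bounds on the weight is
    controlled by the growth of the width, which telescopes over a partition. *)
Lemma weight_gap_le (R : realType) (k s s' r r' : R) :
  0 < k -> 0 < s -> s <= s' -> 0 < r -> r <= r' -> k <= s + r ->
  s' / (s' + r) - s / (s + r') <= k^-1 * (s' + r' - (s + r)).
Proof.
move=> k0 s0 ss r0 rr ks.
have A0 : 0 < s' + r by lra.
have B0 : 0 < s + r' by lra.
have -> : s' / (s' + r) - s / (s + r') =
    ((s' - s) * r' + s * (r' - r)) / ((s' + r) * (s + r')).
  by field; rewrite !gt_eqF.
apply: (@le_trans _ _ ((s' + r' - (s + r)) / (s' + r))).
  rewrite ler_pdivrMr ?mulr_gt0// mulrA divfK ?gt_eqF//.
  have h1 : 0 <= (s' - s) * s by rewrite mulr_ge0//; lra.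
  have h2 : 0 <= (r' - r) * r' by rewrite mulr_ge0//; lra.
  lra.
rewrite [leLHS]mulrC ler_wpM2r//; first by lra.
by rewrite lef_pV2 ?posrE//; lra.
Qed.

Lemma dist_sub_le (R : realDomainType) (f f' g g' l r : R) :
  l <= f - f' <= r -> l <= g - g' <= r -> `|(f' - g') - (f - g)| <= r - l.
Proof. by move=> /andP[? ?] /andP[? ?]; rewrite ler_norml; lra. Qed.

Section IntervalModelLaw.
Context (R : realType) (w : R) (lo hi : R -> R) (F M : R -> R).
Context (FM : moment_cdf w F M)
  (lo_mono : {in `]0, 1[ &, {homo lo : u v /~ u <= v}})
  (hi_mono : {in `]0, 1[ &, {homo hi : u v / u <= v}})
  (lohi : {in `]0, 1[, forall u, [/\ lo u <= w <= hi u, F (hi u) - F (lo u) = u &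
        M (hi u) = M (lo u)]}).
Notation T := (measurableTypeR R).
Notation P := (uniform_square R).
Notation X2 := (terminal_value w lo hi).

Let lo_lt u : 0 < u < 1 -> lo u < w. Proof. exact: (interval_lo_lt FM lohi). Qed.
Let hi_gt u : 0 < u < 1 -> w < hi u. Proof. exact: (interval_hi_gt FM lohi). Qed.
Let mass u : 0 < u < 1 -> F (hi u) - F (lo u) = u.
Proof. by move=> u01; have [] := @lohi u _; rewrite ?in_itv. Qed.
Let lo_le u v : 0 < u -> u <= v -> v < 1 -> lo v <= lo u.
Proof. by move=> u0 uv v1; apply: lo_mono => //; rewrite in_itv/=; apply/andP; split; lra. Qed.
Let hi_le u v : 0 < u -> u <= v -> v < 1 -> hi u <= hi v.
Proof. by move=> u0 uv v1; apply: hi_mono => //; rewrite in_itv/=; apply/andP; split; lra. Qed.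

Definition lo_weight (u : R) : R := (hi u - w) / (hi u - lo u).

Let lo1 (u : R) : R := if u \in `]0, 1[ then lo u else w.
Let hi1 (u : R) : R := if u \in `]0, 1[ then hi u else w.

Let mlo1 : measurable_fun setT (lo1 : T -> T).
Proof.
rewrite (_ : lo1 = fun u => - (if u \in `]0, 1[ then - lo u else - w)); last first.
  by apply/funext => u; rewrite /lo1; case: ifP; rewrite opprK.
apply: measurable_funN; apply: measurable_homo_itv => u v hu hv uv.
by rewrite lerN2 lo_mono.
Qed.

Let mhi1 : measurable_fun setT (hi1 : T -> T).
Proof. exact: measurable_homo_itv. Qed.

Let fstm : measurable_fun setT (fst : T * T -> T). Proof. exact: measurable_fst. Qed.

(* V <= lo_weight U, with the quotient cleared so as not to divide. *)
Let below (x : T * T) : bool :=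
  (x.2 : R) * (hi1 x.1 - lo1 x.1) <= hi1 x.1 - w.

Let mbelow : measurable_fun setT below.
Proof.
have m1 : measurable_fun setT (fun x : T * T => hi1 x.1 : R) by exact: (measurableT_comp mhi1 fstm).
have m2 : measurable_fun setT (fun x : T * T => lo1 x.1 : R) by exact: (measurableT_comp mlo1 fstm).
apply: measurable_fun_ler.
  by apply: measurable_funM => //; exact: measurable_funB.
by apply: measurable_funB.
Qed.

Let belowE x : 0 < x.1 < 1 -> below x = (x.2 <= lo_weight x.1).
Proof.
move=> x01; rewrite /below /lo1 /hi1 in_itv/= x01 /lo_weight ler_pdivlMr//.
by have := lo_lt x01; have := hi_gt x01; lra.
Qed.

Lemma terminal_valueE x : X2 x =
  if x.1 \in `]0, 1[ then if x.2 <= lo_weight x.1 then lo x.1 else hi x.1 else w.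
Proof. by case: x. Qed.

Lemma measurable_terminal_value : measurable_fun setT (X2 : T * T -> T).
Proof.
rewrite (_ : X2 = fun x => if below x then lo1 x.1 else hi1 x.1).
  apply: measurable_fun_ifT => //; [exact: (measurableT_comp mlo1 fstm)|
    exact: (measurableT_comp mhi1 fstm)].
apply/funext => x; rewrite terminal_valueE.
case: ifPn => [|/negbTE x01].
  rewrite in_itv/= => x01; rewrite belowE//.
  by rewrite /lo1 /hi1 in_itv/= x01.
by rewrite /lo1 /hi1 x01; case: ifP.
Qed.

(** The event that U exceeds u and the left end is drawn; it is the model's counterpart of ]-oo, lo
    u]. *)
Definition lo_event (u : R) : set (T * T) := [set x | u < x.1 < 1 /\ below x].
Definition hi_event (u : R) : set (T * T) := [set x | u < x.1 < 1 /\ ~~ below x].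
Let slab (u v : R) : set (T * T) := [set x | u < x.1 <= v /\ below x].

Let mitv (i : interval R) : measurable ([set x | x.1 \in i] : set (T * T)).
Proof.
rewrite -[X in measurable X]setTI.
exact: (fstm measurableT (measurable_itv i)).
Qed.

Let mbelow1 : measurable ([set x | below x] : set (T * T)).
Proof.
rewrite -[X in measurable X]setTI.
exact: (mbelow measurableT (_ : measurable [set true])).
Qed.

Lemma measurable_lo_event u : measurable (lo_event u).
Proof.
rewrite (_ : lo_event u = [set x | x.1 \in `]u, 1[] `&` [set x | below x]).
  exact: measurableI.
by apply/seteqP; split => x; rewrite /lo_event /= in_itv.
Qed.

Lemma measurable_hi_event u : measurable (hi_event u).
Proof.
rewrite (_ : hi_event u = [set x | x.1 \in `]u, 1[] `&` ~` [set x | below x]).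
  by apply: measurableI => //; exact: measurableC.
by apply/seteqP; split => x; rewrite /hi_event /= in_itv => -[? /negP].
Qed.

Let mslab u v : measurable (slab u v).
Proof.
rewrite (_ : slab u v = [set x | x.1 \in `]u, v]] `&` [set x | below x]).
  exact: measurableI.
by apply/seteqP; split => x; rewrite /slab /= in_itv.
Qed.

(** On ]u, v] monotonicity of lo and hi encloses [lo_weight] between two constants, so the slab lies
    between two rectangles. *)
Let slab_bounds u v : 0 < u -> u < v -> v < 1 ->
  (v - u) * ((hi u - w) / (hi u - lo v)) <= fine (P (slab u v))
    <= (v - u) * ((hi v - w) / (hi v - lo u)).
Proof.
move=> u0 uv v1.
have u01 : 0 < u < 1 by lra.
have v01 : 0 < v < 1 by lra.
have lu := lo_lt u01; have lv := lo_lt v01; have hu := hi_gt u01; have hv := hi_gt v01.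
have rect q : 0 <= q <= 1 -> fine (P (`]u, v] `*` `]-oo, q])) = (v - u) * q.
  move=> q01; apply: uniform_square_rect => //; last exact: uniform01_Nyc.
  by apply: uniform01_oc; lra.
have mrect (q : R) : measurable (`]u, v]%classic `*` `]-oo, q]%classic : set (T * T)).
  exact: measurableX.
apply/andP; split.
- rewrite -rect; last first.
    by apply/andP; split; [apply: divr_ge0; lra|rewrite ler_pdivrMr; lra].
  apply: le_fine_prob => // -[x y] [] /=; rewrite !in_itv/= => /andP[ux xv] yq.
  have x01 : 0 < x < 1 by lra.
  split; first by rewrite /= ux xv.
  rewrite belowE//=; apply: (le_trans yq).
  have hux : hi u <= hi x by apply: hi_le; lra.
  have lxv : lo v <= lo x by apply: lo_le; lra.
  have lx := lo_lt x01.
  rewrite /lo_weight ler_pdivrMr; last lra.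
  by rewrite mulrAC ler_pdivlMr; last lra; nra.
- rewrite -rect; last first.
    by apply/andP; split; [apply: divr_ge0; lra|rewrite ler_pdivrMr; lra].
  apply: le_fine_prob => // -[x y] [] /= /andP[ux xv] bx.
  have x01 : 0 < x < 1 by lra.
  split => /=; rewrite in_itv/= ?ux//.
  move: bx; rewrite belowE//= => yx; apply: (le_trans yx).
  have hux : hi x <= hi v by apply: hi_le; lra.
  have lxv : lo x <= lo u by apply: lo_le; lra.
  have lx := lo_lt x01; have hx := hi_gt x01.
  rewrite /lo_weight ler_pdivrMr; last lra.
  by rewrite mulrAC ler_pdivlMr; last lra; nra.
Qed.

Let lo_event_slab u v : 0 < u -> u < v -> v < 1 ->
  fine (P (lo_event u)) = fine (P (slab u v)) + fine (P (lo_event v)).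
Proof.
move=> u0 uv v1; rewrite -fine_probU; [|exact: mslab|exact: measurable_lo_event|].
  congr (fine (P _)); apply/seteqP; split => -[x y] /=.
    case=> /= /andP[ux x1] b; have [xv|vx] := leP x v.
      by left; split => //=; rewrite ux.
    by right; split => //=; rewrite vx.
  by case=> -[/= /andP[ux xv] b]; split => //=; apply/andP; split => //; lra.
apply/seteqP; split => // -[x y] /= [[/= /andP[_ xv] _] [/= /andP[vx _] _]].
by move: xv; rewrite leNgt vx.
Qed.

Let strip (u v : R) : set (T * T) := `]u, v]%classic `*` setT.

Let strip_prob u v : 0 <= u -> u <= v -> v <= 1 -> fine (P (strip u v)) = v - u.
Proof.
move=> u0 uv v1; rewrite -[RHS]mulr1.
apply: uniform_square_rect; [exact: measurable_itv|exact: measurableT|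
  exact: uniform01_oc|exact: probability_setT].
Qed.

Let mstrip u v : measurable (strip u v).
Proof. exact: measurableX. Qed.

Lemma lo_event_le u : 0 < u < 1 -> fine (P (lo_event u)) <= 1 - u.
Proof.
move=> u01; rewrite -strip_prob; [|lra|lra|lra].
apply: le_fine_prob => //; first exact: measurable_lo_event.
by move=> [x y] [/= /andP[ux x1] _]; split => //=; rewrite in_itv/= ux ltW.
Qed.

Let cdf_lo_le u : 0 < u < 1 -> F (lo u) <= 1 - u.
Proof. by move=> u01; have := mass u01; have := mcdf_le1 FM (hi u); lra. Qed.

(** The increments of both sides lie between the same bounds, whose gap is controlled by the growth
    of the width [hi x - lo x]; hence the difference D is constant on [u, 1[. It vanishes in the
    limit v -> 1, both terms being at most 1 - v. *)
Lemma lo_event_prob u : 0 < u < 1 -> fine (P (lo_event u)) = F (lo u).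
Proof.
have [g gE] : exists g : R -> R, forall v, fine (P (lo_event v)) = g v.
  by exists (fun v => fine (P (lo_event v))).
move=> u01; rewrite gE; apply/eqP; rewrite eq_sym -subr_eq0; apply/eqP.
pose D v := F (lo v) - g v.
rewrite -/(D u).
have Dc v : u <= v < 1 -> D u = D v.
  move=> /andP[uv v1].
  have lu := lo_lt u01; have hu := hi_gt u01.
  apply: (@eq_of_small_increments _ D (fun x => hi x - lo x) u v
    (hi u - lo u)^-1) => // a b ua ab bv.
  have a01 : 0 < a < 1 by lra.
  have b01 : 0 < b < 1 by lra.
  have la := lo_lt a01; have ha := hi_gt a01; have lb := lo_lt b01; have hb := hi_gt b01.
  have hh : hi a <= hi b by apply: hi_le; lra.
  have ll : lo b <= lo a by apply: lo_le; lra.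
  have hua : hi u <= hi a by apply: hi_le; lra.
  have lua : lo a <= lo u by apply: lo_le; lra.
  have a0 : 0 < a by lra. have b1 : b < 1 by lra.
  have [s [E B1]] : exists s, g a = s + g b /\
      (b - a) * ((hi a - w) / (hi a - lo b)) <= s <= (b - a) * ((hi b - w) / (hi b - lo a)).
    exists (fine (P (slab a b))); rewrite -!gE.
    by split; [exact: lo_event_slab|exact: slab_bounds].
  have B2 := interval_mass_bounds FM lo_mono hi_mono lohi a0 ab b1.
  set pu := (hi b - w) / (hi b - lo a) in B1 B2.
  set pl := (hi a - w) / (hi a - lo b) in B1 B2.
  have key : pu - pl <= (hi u - lo u)^-1 * (hi b - lo b - (hi a - lo a)).
    have e1 : hi b - lo a = (hi b - w) + (w - lo a) by ring.
    have e2 : hi a - lo b = (hi a - w) + (w - lo b) by ring.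
    have e3 : hi b - lo b - (hi a - lo a) =
      (hi b - w) + (w - lo b) - ((hi a - w) + (w - lo a)) by ring.
    rewrite /pu /pl e1 e2 e3; clear B1 B2 E pu pl.
    by apply: weight_gap_le; lra.
  have ba : 0 <= b - a by rewrite subr_ge0 ltW.
  have K := ler_wpM2l ba key.
  rewrite -(mulrA _ (b - a)) (mulrCA _ (b - a)); apply: le_trans K; rewrite mulrBr.
  by apply: dist_sub_le; [exact: B2|rewrite E addrK; exact: B1].
have Dle v : 0 < v < 1 -> `|D v| <= 1 - v.
  move=> v01; have := lo_event_le v01; have := cdf_lo_le v01.
  have := fine_prob_ge0 P (lo_event v); rewrite gE; have := mcdf_ge0 FM (lo v).
  by rewrite /D ler_norml; lra.
apply/eqP; rewrite -normr_le0; apply/ler_addgt0Pr => e e0; rewrite add0r.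
pose v := Num.max u (1 - e).
have uv : u <= v by rewrite /v le_max lexx.
have v1 : v < 1 by rewrite /v gt_max; apply/andP; split; lra.
have ve : 1 - e <= v by rewrite /v le_max lexx orbT.
rewrite (Dc v) ?uv//; apply: (le_trans (Dle v _)); lra.
Qed.

(** The two events split {u < U < 1}, of probability 1 - u, and F(hi u) - F(lo u) = u. *)
Lemma hi_event_prob u : 0 < u < 1 -> fine (P (hi_event u)) = 1 - F (hi u).
Proof.
move=> u01.
have alg a b x y : a + b = (1 - u) * 1 -> a = x -> y - x = u -> b = 1 - y by lra.
have : fine (P (lo_event u)) + fine (P (hi_event u)) = (1 - u) * 1.
  rewrite -fine_probU; [|exact: measurable_lo_event|exact: measurable_hi_event|].
    have <- : fine (P (`]u, 1[%classic `*` setT)) = (1 - u) * 1.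
      apply: uniform_square_rect; [exact: measurable_itv|exact: measurableT| |
        exact: probability_setT].
      by apply: uniform01_oo; lra.
    congr (fine (P _)); apply/seteqP; split => -[x y] /=.
      by case=> -[/= ? _]; split => //=; rewrite in_itv.
    rewrite in_itv/= => -[x01 _].
    by have [b|b] := boolP (below (x, y)); [left|right].
  by apply/seteqP; split => // x [[_ b] [_ /negP]].
by move/alg; apply; [exact: lo_event_prob|exact: mass].
Qed.

Let mX2 (x : R) : measurable (X2 @^-1` `]-oo, x]%classic : set (T * T)).
Proof.
rewrite -[X in measurable X]setTI.
exact: (measurable_terminal_value measurableT (measurable_itv `]-oo, x])).
Qed.

Let X2_le x : x < w -> [set z | X2 z <= x] =
  [set z | 0 < z.1 < 1 /\ (below z /\ lo z.1 <= x)].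
Proof.
move=> xw; apply/seteqP; split => z /=; rewrite terminal_valueE in_itv/=.
  case: ifPn => [z01|_]; last by rewrite leNgt xw.
  rewrite -belowE//; case: ifPn => // _; have := hi_gt z01; lra.
by case=> z01 [b l]; rewrite z01 -belowE// b.
Qed.

Let X2_gt x : w <= x -> [set z | x < X2 z] =
  [set z | 0 < z.1 < 1 /\ (~~ below z /\ x < hi z.1)].
Proof.
move=> xw; apply/seteqP; split => z /=; rewrite terminal_valueE in_itv/=.
  case: ifPn => [z01|_]; last by rewrite ltNge xw.
  rewrite -belowE//; case: ifPn => // _; have := lo_lt z01; lra.
by case=> z01 [/negbTE b l]; rewrite z01 -belowE// b.
Qed.

(** For x < w only left ends count, and both sides are compared with F(lo u) for u on either side of
    the level where lo passes x; [sandwich_le] gives one inequality in each direction. For x >= w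
    the same is done with upper tails and hi. *)
Lemma terminal_cdf x : fine (P [set z | X2 z <= x]) = F x.
Proof.
have mle : measurable ([set z | X2 z <= x] : set (T * T)).
  rewrite (_ : [set z | X2 z <= x] = X2 @^-1` `]-oo, x]%classic); first exact: mX2.
  by apply/seteqP; split => z /=; rewrite in_itv.
have mgt : measurable ([set z | x < X2 z] : set (T * T)).
  rewrite (_ : [set z | x < X2 z] = ~` [set z | X2 z <= x]); first exact: measurableC.
  by apply/seteqP; split => z /=; rewrite ltNge => /negP.
have lip u v : 0 < u -> u < v -> v < 1 -> F (lo u) - F (lo v) <= v - u.
  move=> u0 uv v1; have := mass (_ : 0 < u < 1); have := mass (_ : 0 < v < 1).
  have := mc_mono FM (hi_le u0 (ltW uv) v1) => h h1 h2.
  by have := h1 ltac:(lra); have := h2 ltac:(lra); lra.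
have liph u v : 0 < u -> u < v -> v < 1 -> (1 - F (hi u)) - (1 - F (hi v)) <= v - u.
  move=> u0 uv v1; have := mass (_ : 0 < u < 1); have := mass (_ : 0 < v < 1).
  have := mc_mono FM (lo_le u0 (ltW uv) v1) => h h1 h2.
  by have := h1 ltac:(lra); have := h2 ltac:(lra); lra.
have strip0 u : 0 < u < 1 -> fine (P (strip 0 u)) = u.
  by move=> u01; rewrite strip_prob ?subr0; lra.
have hile u : 0 < u < 1 -> 1 - F (hi u) <= 1 - u.
  by move=> u01; have := mass u01; have := mcdf_ge0 FM (lo u); lra.
have [xw|wx] := ltP x w.
- have I1 u : 0 < u < 1 -> lo u <= x -> F (lo u) <= fine (P [set z | X2 z <= x]).
    move=> u01 lx; rewrite -(lo_event_prob u01).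
      apply: le_fine_prob; [exact: measurable_lo_event|exact: mle|].
    rewrite X2_le// => z [/andP[uz z1] b]; split; first by lra.
    by split => //; apply: le_trans lx; apply: lo_le; lra.
  have I2 u : 0 < u < 1 -> ~ lo u <= x -> fine (P [set z | X2 z <= x]) <= F (lo u).
    move=> u01 /negP; rewrite -ltNge => lx; rewrite -(lo_event_prob u01).
      apply: le_fine_prob; [exact: mle|exact: measurable_lo_event|].
    rewrite X2_le// => z [z01 [b lz]]; split => //; have [uz|zu] := ltP u z.1; first by lra.
    have := @lo_le z.1 u ltac:(lra) zu ltac:(lra); lra.
  have J1 u : 0 < u < 1 -> lo u <= x -> F (lo u) <= F x.
    by move=> _; exact: (mc_mono FM).
  have J2 u : 0 < u < 1 -> ~ lo u <= x -> F x <= F (lo u).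
    by move=> _ /negP; rewrite -ltNge => /ltW; exact: (mc_mono FM).
  apply/eqP; rewrite eq_le; apply/andP; split.
    apply: (sandwich_le (mcdf_ge0 FM x) J1 I2 _ cdf_lo_le lip) => u u01.
    rewrite -{2}(strip0 u u01) -lo_event_prob//; apply: le_fine_probU => //.
      exact: measurable_lo_event.
    rewrite X2_le// => -[z y] [/= z01 [b lz]]; have [uz|zu] := ltP u z.
      by left; split => //=; lra.
    by right; split => //=; rewrite in_itv/= zu; lra.
  apply: (sandwich_le (fine_prob_ge0 _ _) I1 J2 _ cdf_lo_le lip) => u u01.
  have := mc_mono FM (ltW xw); have := mc_mono FM (ltW (hi_gt u01)).
  by have := mass u01; lra.
- suff : fine (P [set z | x < X2 z]) = 1 - F x.
    rewrite (_ : [set z | x < X2 z] = ~` [set z | X2 z <= x]).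
      move=> h; apply/oppr_inj/(@addrI _ 1); exact: etrans (esym (fine_probC P mle)) h.
    by apply/seteqP; split => z /=; rewrite ltNge => /negP.
  have I1 u : 0 < u < 1 -> x < hi u -> 1 - F (hi u) <= fine (P [set z | x < X2 z]).
    move=> u01 lx; rewrite -(hi_event_prob u01).
      apply: le_fine_prob; [exact: measurable_hi_event|exact: mgt|].
    rewrite X2_gt// => z [/andP[uz z1] b]; split; first by lra.
    by split => //; apply: (lt_le_trans lx); apply: hi_le; lra.
  have I2 u : 0 < u < 1 -> ~ x < hi u -> fine (P [set z | x < X2 z]) <= 1 - F (hi u).
    move=> u01 /negP; rewrite -leNgt => lx; rewrite -(hi_event_prob u01).
      apply: le_fine_prob; [exact: mgt|exact: measurable_hi_event|].
    rewrite X2_gt// => z [z01 [b lz]]; split => //; have [uz|zu] := ltP u z.1; first by lra.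
    have := @hi_le z.1 u ltac:(lra) zu ltac:(lra); lra.
  have J1 u : 0 < u < 1 -> x < hi u -> 1 - F (hi u) <= 1 - F x.
    by move=> _ /ltW /(mc_mono FM); lra.
  have J2 u : 0 < u < 1 -> ~ x < hi u -> 1 - F x <= 1 - F (hi u).
    by move=> _ /negP; rewrite -leNgt => /(mc_mono FM); lra.
  have F1 : 0 <= 1 - F x by have := mcdf_le1 FM x; lra.
  apply/eqP; rewrite eq_le; apply/andP; split.
    apply: (sandwich_le (Phi := fun u => 1 - F (hi u)) F1 J1 I2 _ hile liph) => u u01.
    rewrite -{2}(strip0 u u01) -hi_event_prob//; apply: le_fine_probU => //.
      exact: measurable_hi_event.
    rewrite X2_gt// => -[z y] [/= z01 [b lz]]; have [uz|zu] := ltP u z.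
      by left; split => //=; lra.
    by right; split => //=; rewrite in_itv/= zu; lra.
  apply: (sandwich_le (Phi := fun u => 1 - F (hi u)) (fine_prob_ge0 _ _) I1 J2 _ hile liph) => u u01.
  have := mc_mono FM wx; have := mc_mono FM (ltW (lo_lt u01)).
  by have := mass u01; lra.
Qed.

End IntervalModelLaw.

(** * Hedging in consistent models *)

Section Transfer.
Context (R : realType) (d : measure_display) (Omega : measurableType d)
  (P : probability Omega R) (Y : Omega -> R) (m : probability (measurableTypeR R) R)
  (mY : measurable_fun setT (Y : Omega -> measurableTypeR R)) (YE : has_law P Y m).

Let Ym : {mfun Omega >-> measurableTypeR R} :=
  HB.pack (Y : Omega -> measurableTypeR R) (isMeasurableFun.Build _ _ _ _ _ mY).

Lemma ge0_integral_law (f : R -> R) : measurable_fun setT (f : measurableTypeR R -> R) ->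
  (forall y, 0 <= f y) ->
  (\int[P]_x (f (Y x))%:E = \int[m]_y (f y)%:E)%E.
Proof.
move=> mf f0.
transitivity (\int[pushforward P Ym]_y (f y)%:E)%E; last first.
  by apply: eq_measure_integral => A mA _; exact: YE.
rewrite ge0_integral_pushforward//; [exact/measurable_EFinP|].
by move=> y _; rewrite lee_fin.
Qed.

Lemma integrable_law (f : R -> R) : m.-integrable setT (EFin \o f) ->
  P.-integrable setT (fun x => (f (Y x))%:E).
Proof.
move=> fi; have mf : measurable_fun setT (f : measurableTypeR R -> R).
  by have := measurable_int m fi => /measurable_EFinP.
apply/integrableP; split; first by apply/measurable_EFinP; exact: (measurableT_comp mf mY).
have := @ge0_integral_law (fun y => `|f y|); rewrite /= => ->//.
  by case/integrableP : fi.
exact: measurableT_comp.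
Qed.

Lemma integral_law (f : R -> R) : m.-integrable setT (EFin \o f) ->
  \int[P]_x f (Y x) = \int[m]_y f y.
Proof.
move=> fi; have mf : measurable_fun setT (f : measurableTypeR R -> R).
  by have := measurable_int m fi => /measurable_EFinP.
rewrite /Rintegral; congr fine.
transitivity (\int[pushforward P Ym]_y (f y)%:E)%E; last first.
  by apply: eq_measure_integral => A mA _; exact: YE.
rewrite integral_pushforward//; first exact/measurable_EFinP.
exact: integrable_law.
Qed.

End Transfer.

Lemma probability_eq_cdf (R : realType) (m1 m2 : probability (measurableTypeR R) R) :
  (forall x : R, m1 `]-oo, x]%classic = m2 `]-oo, x]%classic) ->
  forall A, measurable A -> m1 A = m2 A.
Proof.
move=> H; apply: (@measure_unique _ R (measurableTypeR R) (@RGenOInfty.G R)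
  (fun n => `]- n%:R, +oo[%classic) _ _ _ _ m1 m2).
- exact: RGenOInfty.measurableE.
- move=> _ _ [x ->] [y ->]; exists (Num.max x y).
  by apply/seteqP; split => z /=; rewrite !in_itv/= !andbT gt_max => /andP.
- by move=> n; exists (- n%:R).
- apply/seteqP; split => // x _; exists (Num.bound `|x|) => //=.
  rewrite in_itv/= andbT; have : `|x| < (Num.bound `|x|)%:R by exact: archi_boundP.
  by rewrite ltr_norml => /andP[].
- move=> _ [x ->]; rewrite -setCitvl.
  have h (m : probability (measurableTypeR R) R) :
    m (~` `]-oo, x]%classic) = (1 - m `]-oo, x]%classic)%E by exact: probability_setC.
  by transitivity (1 - m1 `]-oo, x]%classic)%E; [|rewrite H]; rewrite -h.
- by move=> n; exact: (le_lt_trans (probability_le1 _ _) (ltry _)).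
Qed.

Section ConsistentModels.
Context (R : realType) (d : measure_display) (Omega : measurableType d)
  (P : probability Omega R) (F : 'I_3 -> set (set Omega)) (X : 'I_3 -> Omega -> R)
  (w : R) (nu : probability (measurableTypeR R) R).
Context (FX : consistent_model P (@dirac _ (measurableTypeR R) w R) nu F X).

Let Fm t : F t `<=` measurable. Proof. by case: FX => -[]. Qed.

Lemma model_measurable t : measurable_fun setT (X t : Omega -> measurableTypeR R).
Proof.
move=> _ B mB; rewrite setTI; apply: (@Fm t).
by case: FX => _ [+ _ _] _ _ _; apply.
Qed.

Let X2law : has_law P (X t2) nu. Proof. by case: FX. Qed.

Let Xint t : P.-integrable setT (EFin \o X t).
Proof. by case: FX => _ [_ + _] _ _ _; apply. Qed.

Section Hedge.
Context (A : set Omega) (f : R -> R) (b c : R) (FA : F t1 A)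
  (fi : nu.-integrable setT (EFin \o f)).

(* Value at date 2 of the cash c, the static claim f(X_2) and, on the event A,
   of b units of stock sold short at date 1. *)
Definition hedge (x : Omega) : R :=
  c + (f (X t2 x) - b * ((\1_A : Omega -> R) x * (X t2 x - X t1 x))).

Let mA : measurable A. Proof. exact: (Fm FA). Qed.

Let Xdi : P.-integrable setT (EFin \o (fun x => X t2 x - X t1 x)).
Proof. exact: (integrableB measurableT (Xint t2) (Xint t1)). Qed.

Let gain_patch : (fun x => (\1_A : Omega -> R) x * (X t2 x - X t1 x)) =
  (fun x => X t2 x - X t1 x) \_ A.
Proof.
by apply/funext => x; rewrite patchE indicE; case: ifP => _; rewrite ?mul1r ?mul0r.
Qed.

Let gain_integrable :
  P.-integrable setT (EFin \o (fun x => (\1_A : Omega -> R) x * (X t2 x - X t1 x))).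
Proof.
rewrite gain_patch.
have -> : EFin \o (fun x => X t2 x - X t1 x) \_ A = (EFin \o (fun x => X t2 x - X t1 x)) \_ A.
  by rewrite restrict_EFin.
by rewrite -integrable_mkcond//; apply: integrableS Xdi.
Qed.

(** The position is opened at date 1 on an event known at date 1, so the martingale property makes
    its mean gain zero. *)
Let gain_integral : \int[P]_x ((\1_A : Omega -> R) x * (X t2 x - X t1 x)) = 0.
Proof.
rewrite gain_patch -Rintegral_mkcond RintegralB//; try by apply: integrableS (Xint _).
case: FX => _ [_ _ H] _ _ _; have := H t1 t2 isT A FA.
by rewrite /Rintegral => ->; rewrite subrr.
Qed.

Lemma hedge_integrable : P.-integrable setT (EFin \o hedge).
Proof.
apply: (@integrableD _ _ _ _ _ _ (EFin \o cst c)
  (fun x => (f (X t2 x) - b * ((\1_A : Omega -> R) x * (X t2 x - X t1 x)))%:E)) => //.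
  exact: finite_measure_integrable_cst.
apply: (@integrableB _ _ _ _ _ _ (fun x => (f (X t2 x))%:E)
  (fun x => (b * ((\1_A : Omega -> R) x * (X t2 x - X t1 x)))%:E)) => //.
  exact: (integrable_law (model_measurable t2) X2law fi).
exact: (integrableZl measurableT b gain_integrable).
Qed.

Lemma hedge_integral : (\int[P]_x (hedge x)%:E = c%:E + \int[nu]_y (f y)%:E)%E.
Proof.
have h1 : P.-integrable setT (EFin \o (fun x => f (X t2 x))).
  exact: (integrable_law (model_measurable t2) X2law fi).
have h2 : P.-integrable setT (EFin \o (fun x => b * ((\1_A : Omega -> R) x * (X t2 x - X t1 x)))).
  exact: (integrableZl measurableT b gain_integrable).
have hE : \int[P]_x hedge x = c + \int[nu]_y f y.
  rewrite /hedge RintegralD//; last 2 first.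
  - exact: finite_measure_integrable_cst.
  - exact: (integrableB measurableT h1 h2).
  rewrite RintegralB// (integral_law (model_measurable t2) X2law fi).
  rewrite RintegralZl// gain_integral mulr0 subr0.
  rewrite Rintegral_cst//; congr (_ + _); rewrite -[RHS]mulr1; congr (_ * _).
  exact: (congr1 fine (probability_setT P)).
rewrite -[LHS]fineK; last exact: (integrable_fin_num measurableT hedge_integrable).
rewrite -[X in (_ + X)%E]fineK; last exact: (integrable_fin_num measurableT fi).
by rewrite -EFinD -hE.
Qed.

End Hedge.

Section Exercise.
Context (K1 K2 : R) (tau : Omega -> 'I_3) (tauF : exercise_time F tau).
Notation A := [set x | (tau x <= t1)%N].

Lemma put_payoffE x : put_payoff K1 K2 X tau x =
  if (tau x <= t1)%N then Num.max (K1 - X t1 x) 0 else Num.max (K2 - X t2 x) 0.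
Proof. by rewrite /put_payoff; case: (tauF.1 x) => ->. Qed.

Lemma measurable_put_payoff : measurable_fun setT (put_payoff K1 K2 X tau).
Proof.
rewrite (funext put_payoffE).
have mm (K : R) t : measurable_fun setT (fun x => Num.max (K - X t x) 0).
  apply: measurable_maxr => //; apply: measurable_funB => //; exact: model_measurable.
apply: measurable_fun_ifT => //.
apply: (measurable_fun_bool true) => //; rewrite setTI.
rewrite (_ : _ @^-1` _ = A); first by apply: (@Fm t1); exact: tauF.2.
by apply/seteqP; split => x /=.
Qed.

Lemma put_payoff_ge0 x : 0 <= put_payoff K1 K2 X tau x.
Proof. by rewrite /put_payoff le_max lexx orbT. Qed.

Let X1null : P [set x | X t1 x != w] = 0%E.
Proof.
case: FX => _ _ _ X1law _.
rewrite (_ : [set x | X t1 x != w] = X t1 @^-1` ~` [set w]).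
  have -> : P (X t1 @^-1` ~` [set w]) = \d_w (~` [set w] : set (measurableTypeR R)).
    by apply: X1law; exact: measurableC.
  by rewrite diracE memNset//; apply.
by apply/seteqP; split => x /= /eqP.
Qed.

Let mX1 : measurable [set x | X t1 x != w].
Proof.
rewrite (_ : [set x | X t1 x != w] = X t1 @^-1` ~` [set w]).
  rewrite -[X in measurable X]setTI; apply: (model_measurable t1 measurableT).
  exact: measurableC.
by apply/seteqP; split => x /= /eqP.
Qed.

(** X_1 has law delta_w, so paths with X_1 != w form a null set and the hedge need only dominate
    where X_1 = w. *)
Lemma price_le_hedge (f : R -> R) (b c : R) : nu.-integrable setT (EFin \o f) ->
  (forall x, X t1 x = w -> put_payoff K1 K2 X tau x <= hedge A f b c x) ->
  ('E_P[put_payoff K1 K2 X tau] <= c%:E + \int[nu]_y (f y)%:E)%E.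
Proof.
move=> fi H; have FA : F t1 A by exact: tauF.2.
rewrite -(hedge_integral b c FA fi) unlock.
have hi := hedge_integrable b c FA fi.
rewrite (negligible_integral mX1 measurableT hi X1null).
rewrite (ge0_negligible_integral mX1 measurableT _ _ X1null); last 2 first.
- by apply/measurable_EFinP; exact: measurable_put_payoff.
- by move=> x _; rewrite lee_fin put_payoff_ge0.
have E x : (setT `\` [set x | X t1 x != w]) x -> X t1 x = w.
  by case=> _ /= /negP; rewrite negbK => /eqP.
apply: ge0_le_integral.
- exact: measurableD.
- by move=> x _; rewrite lee_fin put_payoff_ge0.
- by apply: measurable_funTS; apply/measurable_EFinP; exact: measurable_put_payoff.
- by apply: measurable_funTS; exact: (measurable_int P hi).
- by move=> x /E Xx; rewrite lee_fin; exact: H.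
Qed.

Lemma hedge_eq_price (f : R -> R) (b c : R) (N : set Omega) :
  nu.-integrable setT (EFin \o f) -> measurable N -> P N = 0%E ->
  (forall x, ~ N x -> put_payoff K1 K2 X tau x = hedge A f b c x) ->
  ('E_P[put_payoff K1 K2 X tau] = c%:E + \int[nu]_y (f y)%:E)%E.
Proof.
move=> fi mN N0 H; have FA : F t1 A by exact: tauF.2.
rewrite -(hedge_integral b c FA fi) unlock.
have hi := hedge_integrable b c FA fi.
rewrite (negligible_integral mN measurableT hi N0).
rewrite (ge0_negligible_integral mN measurableT _ _ N0); last 2 first.
- by apply/measurable_EFinP; exact: measurable_put_payoff.
- by move=> x _; rewrite lee_fin put_payoff_ge0.
by apply: eq_integral => x; rewrite inE => -[_ /H] /= ->.
Qed.

End Exercise.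
End ConsistentModels.

(** * The interval model is consistent *)

Section IntervalModelConsistent.
Context (R : realType) (w : R) (nu : probability (measurableTypeR R) R)
  (nu_atomless : atomless nu)
  (nu_integrable : nu.-integrable setT (EFin \o id : R -> \bar R))
  (nu_mean : (\int[nu]_x x%:E = w%:E)%E)
  (lo hi : R -> R) (lohi : barycentric_intervals nu w lo hi).
Notation T := (measurableTypeR R).
Notation P := (uniform_square R).
Notation X2 := (terminal_value w lo hi).

Let FM : moment_cdf w (lcdf nu) (lmoment nu w) := law_moment_cdf nu_atomless nu_integrable nu_mean.

Let lohi_cdf := proj1 (barycentric_cdf w nu_atomless nu_integrable lo hi) lohi.
Let lo_mono : {in `]0, 1[ &, {homo lo : u v /~ u <= v}}. Proof. by case: lohi_cdf. Qed.
Let hi_mono : {in `]0, 1[ &, {homo hi : u v / u <= v}}. Proof. by case: lohi_cdf. Qed.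
Let lohi3 : {in `]0, 1[, forall u, [/\ lo u <= w <= hi u, lcdf nu (hi u) - lcdf nu (lo u) = u &
        lmoment nu w (hi u) = lmoment nu w (lo u)]}.
Proof. by case: lohi_cdf. Qed.

Lemma barycentric_lo_lt u : 0 < u < 1 -> lo u < w.
Proof. exact: (interval_lo_lt FM lohi3). Qed.

Lemma barycentric_hi_gt u : 0 < u < 1 -> w < hi u.
Proof. exact: (interval_hi_gt FM lohi3). Qed.

Let mX2 : measurable_fun setT (X2 : T * T -> T).
Proof. exact: (measurable_terminal_value FM lo_mono hi_mono lohi3). Qed.

Let X2m : {mfun (T * T)%type >-> T} := HB.pack (X2 : T * T -> T) (isMeasurableFun.Build _ _ _ _ _ mX2).

Lemma terminal_law : has_law P (X2 : T * T -> R) nu.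
Proof.
move=> B mB.
apply: (probability_eq_cdf (m1 := distribution P X2m) (m2 := nu)) => // x.
have h : fine (P [set z | X2 z <= x]) = fine (nu `]-oo, x]%classic).
  exact: (terminal_cdf FM lo_mono hi_mono lohi3 x).
have E : distribution P X2m `]-oo, x]%classic = P [set z | X2 z <= x].
  by rewrite /distribution /pushforward; congr (P _); apply/seteqP; split => z /=; rewrite in_itv.
have f1 : distribution P X2m `]-oo, x]%classic \is a fin_num by exact: fin_num_measure.
have f2 : nu `]-oo, x]%classic \is a fin_num by exact: fin_num_measure.
apply: etrans (esym (fineK f1)) (etrans (congr1 EFin _) (fineK f2)).
exact: etrans (congr1 fine E) h.
Qed.

(** The probability p of the left end solves p lo + (1 - p) hi = w. The default value w extends the
    identity to every x, so Fubini's theorem meets no exceptional set. *)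
Lemma terminal_value_fibre_mean (x : R) : (\int[uniform01 R]_y (X2 (x, y))%:E = w%:E)%E.
Proof.
rewrite /terminal_value.
have [|_] := boolP (x \in `]0, 1[); last first.
  transitivity (\int[uniform01 R]_y (cst w%:E) y)%E; first by apply: eq_integral.
  by rewrite integral_cst// [X in (_ * X)%E]probability_setT mule1.
rewrite in_itv/= => x01.
have l := barycentric_lo_lt x01; have h := barycentric_hi_gt x01.
set p := (hi x - w) / (hi x - lo x).
have p01 : 0 <= p <= 1.
  by rewrite /p; apply/andP; split; [apply: divr_ge0; lra|rewrite ler_pdivrMr; lra].
have TE : [set: T] = `]-oo, p]%classic `|` `]p, +oo[%classic by rewrite -setCitvl setUv.
have mp : measurable_fun setT (fun y : T => (if y <= p then lo x else hi x)%:E).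
  apply/measurable_EFinP; apply: measurable_fun_ifT => //.
  exact: measurable_fun_ler.
rewrite TE integral_setU//; last 2 first.
- by rewrite -TE.
- by rewrite -setCitvl; apply/disj_setPS => z [].
rewrite (eq_integral (cst (lo x)%:E)); last first.
  by move=> y; rewrite inE /= in_itv/= => ->.
rewrite integral_cst//.
rewrite (eq_integral (cst (hi x)%:E)); last first.
  by move=> y; rewrite inE /= in_itv/= andbT ltNge => /negbTE ->.
rewrite integral_cst//.
have u1 : uniform01 R `]-oo, p]%classic = p%:E by exact: uniform01_Nyc.
have u2 : uniform01 R `]p, +oo[%classic = (1 - p)%:E.
  transitivity (uniform01 R (~` `]-oo, p]%classic)); first by rewrite setCitvl.
  have c : uniform01 R (~` `]-oo, p]%classic) = (1 - uniform01 R `]-oo, p]%classic)%E.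
    exact: probability_setC.
  by rewrite c u1.
rewrite [X in (_ * X + _)%E]u1 [X in (_ + _ * X)%E]u2 -!EFinM -EFinD; congr EFin.
by rewrite /p; field; rewrite gt_eqF//; lra.
Qed.

(** F_0 is taken to be sigma(U) instead of trivial: X_0 = X_1 = w is constant and the martingale
    property holds against the larger field too, so only two fields occur. *)
Definition interval_filtration (t : 'I_3) : set (set (T * T)) :=
  if t == t2 then measurable else [set A | exists2 B : set T, measurable B & A = fst @^-1` B].

Let fstm : measurable_fun setT (fst : T * T -> T). Proof. exact: measurable_fst. Qed.

Let early_measurable (A : set (T * T)) :
  (exists2 B : set T, measurable B & A = fst @^-1` B) -> measurable A.
Proof.
case=> B mB ->; rewrite -[X in measurable X]setTI.
exact: (fstm measurableT mB).
Qed.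

Lemma interval_filtrationP : filtration interval_filtration.
Proof.
split.
- move=> t; rewrite /interval_filtration; case: ifP => _.
    exact: sigma_algebra_measurable.
  split.
  + by exists set0 => //; rewrite preimage_set0.
  + move=> _ [B mB ->]; exists (~` B); first exact: measurableC.
    by rewrite setTD preimage_setC.
  + move=> G HG; pose B n := sval (cid2 (HG n)).
    exists (\bigcup_n B n).
      by apply: bigcup_measurable => n _; rewrite /B; case: cid2.
    rewrite preimage_bigcup; apply: eq_bigcupr => n _; rewrite /B; by case: cid2.
- move=> t A; rewrite /interval_filtration; case: ifP => // _; exact: early_measurable.
- move=> s t st A; rewrite /interval_filtration.
  case: ifPn => [/eqP s2|_]; case: ifPn => // t2'.
  + by move: st t2'; rewrite s2; case: t => -[|[|[|]]].
  + exact: early_measurable.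
Qed.

Let X2int : P.-integrable setT (EFin \o (X2 : T * T -> R)).
Proof. exact: (integrable_law mX2 terminal_law nu_integrable). Qed.

(** Integrate over V first: every fibre of X_2 over a value of U has mean w. *)
Let early_martingale (B : set T) : measurable B ->
  (\int[P]_(z in fst @^-1` B) (X2 z)%:E = \int[P]_(z in fst @^-1` B) w%:E)%E.
Proof.
move=> mB; have mA : measurable (fst @^-1` B : set (T * T)).
  by apply: early_measurable; exists B.
rewrite [LHS]integral_mkcond [RHS]integral_mkcond.
have cint : P.-integrable setT (EFin \o (cst w : T * T -> R)).
  exact: finite_measure_integrable_cst.
have i1 : P.-integrable setT ((EFin \o (X2 : T * T -> R)) \_ (fst @^-1` B)).
  by rewrite -integrable_mkcond//; apply: integrableS X2int.
have i2 : P.-integrable setT ((EFin \o (cst w : T * T -> R)) \_ (fst @^-1` B)).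
  by rewrite -integrable_mkcond//; apply: integrableS cint.
have := @integral12_prod_meas1 _ _ T T R (uniform01 R) (uniform01 R) _ i1.
have := @integral12_prod_meas1 _ _ T T R (uniform01 R) (uniform01 R) _ i2.
move=> E2 E1; transitivity (\int[uniform01 R]_x
    fubini_F (uniform01 R) ((EFin \o (X2 : T * T -> R)) \_ (fst @^-1` B)) x)%E; first exact: esym.
transitivity (\int[uniform01 R]_x
    fubini_F (uniform01 R) ((EFin \o (cst w : T * T -> R)) \_ (fst @^-1` B)) x)%E; last exact: E2.
apply: eq_integral => x _; rewrite /fubini_F.
have [xB|xB] := boolP (x \in B).
  transitivity (\int[uniform01 R]_y (X2 (x, y))%:E)%E.
    by apply: eq_integral => y _; rewrite patchE ifT//; rewrite inE/=; rewrite inE in xB.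
  rewrite terminal_value_fibre_mean; transitivity (\int[uniform01 R]_y (cst w%:E) y)%E.
    by rewrite integral_cst// [X in (_ * X)%E]probability_setT mule1.
  by apply: eq_integral => y _; rewrite patchE ifT//; rewrite inE/=; rewrite inE in xB.
apply: eq_integral => y _; rewrite !patchE !ifF//; apply/negbTE; rewrite notin_setE/=;
  by move: xB; rewrite notin_setE.
Qed.

Lemma interval_model_consistent :
  consistent_model P (@dirac _ (measurableTypeR R) w R) nu interval_filtration
    (interval_process w lo hi).
Proof.
split.
- exact: interval_filtrationP.
- split.
  + move=> t B mB; rewrite /interval_filtration /interval_process; case: ifPn => _.
      by rewrite -[X in measurable X]setTI; exact: (mX2 measurableT mB).
    by exists (if w \in B then setT else set0); [case: ifP|rewrite preimage_cst; case: ifP].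
  + move=> t; rewrite /interval_process; case: ifPn => _; first exact: X2int.
    exact: finite_measure_integrable_cst.
  + move=> s t st A; rewrite /interval_filtration /interval_process.
    have [tE|tn2] := eqVneq t t2; have [sE|sn2] := eqVneq s t2 => //.
      by case=> B mB ->; exact: early_martingale.
    by move=> _; move: st tn2; rewrite sE; case: t => -[|[|[|]]].
- apply/aeW => x; rewrite /interval_process /= integral_dirac//.
  by rewrite diracT mul1e.
- move=> B mB; rewrite /interval_process /= preimage_cst diracE.
  by case: ifP => // _; [exact: probability_setT|exact: measure0].
- exact: terminal_law.
Qed.

Lemma threshold_exercise_time u : exercise_time interval_filtration (threshold_time u).
Proof.
split=> [x|t]; first by rewrite /threshold_time; case: ifP; [left|right].
have mU : measurable (`]-oo, u[%classic : set T) by [].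
(* Dates 0 and 1 carry the same field and date 2 a larger one, so membership at date 1 suffices for
   every t. *)
suff H : interval_filtration t1 [set x | (threshold_time u x <= t)%N].
  move: H; rewrite /interval_filtration /=; case: ifP => // _.
  exact: early_measurable.
rewrite /interval_filtration /=.
have [tt|tt] := leqP t2 t.
  exists setT => //; rewrite preimage_setT; apply/seteqP; split => // x _ /=.
  by rewrite (leq_trans _ tt)// /threshold_time; case: ifP.
have [t1t|t1t] := leqP t1 t.
  exists `]-oo, u[%classic => //; apply/seteqP; split => x /=; rewrite in_itv/= /threshold_time.
    by case: ifP => // _ h; have := leq_ltn_trans h tt.
  by move=> ->.
exists set0 => //; rewrite preimage_set0; apply/seteqP; split => // x /=.
by rewrite /threshold_time; case: ifP => _ h; have := leq_ltn_trans h t1t.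
Qed.

Lemma threshold_le_highest K1 K2 u : (threshold_value w lo hi K1 K2 u <=
  highest_model_price (@dirac _ (measurableTypeR R) w R) nu K1 K2)%E.
Proof.
apply: (@le_trans _ _ (american_price P K1 K2 interval_filtration (interval_process w lo hi))).
  by apply: ereal_sup_ubound; exists (threshold_time u) => //; exact: threshold_exercise_time.
apply: ereal_sup_ubound; exists _, _, P, interval_filtration, (interval_process w lo hi).
by split => //; exact: interval_model_consistent.
Qed.

End IntervalModelConsistent.

(** * Weak duality *)

Section Convexity.
Context (R : realType) (psi : R -> R).

Lemma convex_functionP : convex_function (setT : set R) psi <->
  forall t x y : R, 0 <= t <= 1 -> psi (t * x + (1 - t) * y) <= t * psi x + (1 - t) * psi y.
Proof.
split=> [H t x y /andP[t0 t1]|H t x y _ _].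
  exact: (H (Itv01 t0 t1) x y (in_setT _) (in_setT _)).
by apply: H; rewrite ge0 le1.
Qed.

Context (cpsi : convex_function (setT : set R) psi).

Lemma convex_three_points a c b : a < c -> c < b ->
  psi c * (b - a) <= psi a * (b - c) + psi b * (c - a).
Proof.
move=> ac cb; have ab : 0 < b - a by lra.
have t01 : 0 <= (b - c) / (b - a) <= 1.
  by apply/andP; split; [apply: divr_ge0; lra|rewrite ler_pdivrMr; lra].
have := (proj1 convex_functionP cpsi) _ a b t01.
have -> : (b - c) / (b - a) * a + (1 - (b - c) / (b - a)) * b = c.
  by field; rewrite gt_eqF.
have -> : (b - c) / (b - a) * psi a + (1 - (b - c) / (b - a)) * psi b =
    (psi a * (b - c) + psi b * (c - a)) / (b - a).
  by field; rewrite gt_eqF.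
by rewrite ler_pdivlMr.
Qed.

(** The slope m is the left derivative at w, the supremum of the difference quotients from the left,
    which those from the right bound above. *)
Lemma convex_subgradient w : exists m, forall x, psi w + m * (x - w) <= psi x.
Proof.
pose S := [set (psi w - psi a) / (w - a) | a in [set a : R | a < w]].
have ub b : w < b -> ubound S ((psi b - psi w) / (b - w)).
  move=> wb _ [a /= aw <-]; have := convex_three_points aw wb => h.
  by rewrite ler_pdivrMr ?subr_gt0// mulrAC ler_pdivlMr ?subr_gt0//; nra.
have hs : has_sup S.
  split; first by exists ((psi w - psi (w - 1)) / (w - (w - 1))), (w - 1) => //=; lra.
  by exists ((psi (w + 1) - psi w) / (w + 1 - w)); apply: ub; lra.
exists (sup S) => x; have [xw|wx|->] := ltgtP x w.
- have : (psi w - psi x) / (w - x) <= sup S by apply: (sup_upper_bound hs); exists x.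
  by rewrite ler_pdivrMr ?subr_gt0//; lra.
- have : sup S <= (psi x - psi w) / (x - w) by apply: ge_sup (ub _ wx); exact: hs.1.
  by rewrite ler_pdivlMr ?subr_gt0//; lra.
- by rewrite subrr mulr0 addr0.
Qed.

(** Strict sublevel sets of a convex function are intervals. *)
Lemma convex_measurable : measurable_fun setT (psi : measurableTypeR R -> measurableTypeR R).
Proof.
apply: (measurability (@RGenInftyO.G R)) => [|/= _ [_] [r] -> <-].
  exact: RGenInftyO.measurableE.
rewrite setTI; apply: is_interval_measurable => s t /=.
rewrite !in_itv/= => ps pt u /andP[]; rewrite le_eqVlt => /predU1P[<-//|su].
rewrite le_eqVlt => /predU1P[->//|ut]; rewrite in_itv/=.
have h := convex_three_points su ut.
have h1 : psi s * (t - u) < r * (t - u) by rewrite ltr_pM2r//; lra.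
have h2 : psi t * (u - s) < r * (u - s) by rewrite ltr_pM2r//; lra.
by rewrite -(@ltr_pM2r _ (t - s)); lra.
Qed.

End Convexity.

Lemma weak_duality (R : realType) (w K1 K2 : R) (nu : probability (measurableTypeR R) R) :
  (highest_model_price (@dirac _ (measurableTypeR R) w R) nu K1 K2 <=
    dual_bound nu w K1 K2)%E.
Proof.
apply: ge_ereal_sup => p; case=> d; case=> Omega; case=> P; case=> F; case=> X; case=> FX ->.
apply: ge_ereal_sup => _ [tau tauF <-].
apply: le_ereal_inf_tmp => _ [psi [cpsi psiK] <-].
have psi0 z : 0 <= psi z by apply: le_trans (psiK z); rewrite le_max lexx orbT.
rewrite /dual_cost; set c := Num.max (_ - psi w) 0.
(* A claim of infinite cost bounds every price; otherwise psi >= 0 is integrable and can enter a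
   hedge. *)
have [psioo|] := eqVneq (\int[nu]_y (psi y)%:E)%E +oo%E.
  by rewrite psioo addey// leey.
rewrite -ltey => psifin.
have psii : nu.-integrable setT (EFin \o psi).
  apply/integrableP; split; first by apply/measurable_EFinP; exact: convex_measurable.
  apply: le_lt_trans psifin; rewrite le_eqVlt; apply/orP; left; apply/eqP.
  by apply: eq_integral => y _ /=; rewrite ger0_norm.
have [m Hm] := convex_subgradient cpsi w.
apply: (price_le_hedge FX tauF (b := m)) => // x Xw.
rewrite (put_payoffE _ _ _ tauF) /hedge.
have c0 : 0 <= c by rewrite /c le_max lexx orbT.
have c1 : Num.max (K1 - w) 0 - psi w <= c by rewrite /c le_max lexx.
(* On A the subgradient gives c + psi(X_2) - m (X_2 - w) >= c + psi(w) >= (K1 - w)^+; off A,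
   psi(X_2) >= (K2 - X_2)^+ and c >= 0. *)
case: ifPn => tx.
  rewrite indicE mem_set//= mul1r Xw; have := Hm (X t2 x); lra.
rewrite indicE memNset//=; last by apply/negP.
by rewrite mul0r mulr0 subr0; have := psiK (X t2 x); lra.
Qed.

(** In the application f and g are the left and right slopes seen from (w, K1 - w). The point u0 is
    the supremum of the u with g u <= f u, with 0 added in case there is none; f u1 < g u1 keeps it
    below 1. Both functions may jump at u0, so b is the supremum of the values of g before u0 and of
    f after it. *)
Lemma monotone_crossing (R : realType) (f g : R -> R) (u1 : R) :
  (forall u v, 0 < u -> u <= v -> v < 1 -> f v <= f u) ->
  (forall u v, 0 < u -> u <= v -> v < 1 -> g u <= g v) ->
  0 < u1 < 1 -> f u1 < g u1 ->
  exists u0 b, 0 <= u0 < 1 /\ forall u, 0 < u < 1 ->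
    (u < u0 -> g u <= b <= f u) /\ (u0 < u -> f u <= b <= g u).
Proof.
move=> fm gm u101 fg1.
pose S : set R := [set u | u = 0 \/ 0 < u < 1 /\ g u <= f u].
have Su1 u : S u -> u <= u1.
  case=> [->|[u01 h]]; first by lra.
  rewrite leNgt; apply/negP => u1u.
  have := @fm u1 u ltac:(lra) (ltW u1u) ltac:(lra).
  by have := @gm u1 u ltac:(lra) (ltW u1u) ltac:(lra); lra.
have hs : has_sup S by split; [exists 0; left|exists u1].
have s0 : 0 <= sup S by apply: (sup_upper_bound hs); left.
have s1 : sup S <= u1 by apply: ge_sup Su1; exact: hs.1.
have below u : 0 < u -> u < sup S -> g u <= f u.
  move=> u0 us; have us' : 0 < sup S - u by lra.
  have [v Sv sv] := sup_adherent us' hs.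
  have {}sv : u < v by lra.
  case: Sv => [v0|[v01 h]]; first by lra.
  have v1 : v < 1 by lra.
  by have := fm _ _ u0 (ltW sv) v1; have := gm _ _ u0 (ltW sv) v1; lra.
have above u : sup S < u -> u < 1 -> f u <= g u.
  move=> su u1'; rewrite leNgt; apply/negP => gf.
  have : S u by right; split; [lra|exact: ltW].
  by move/(sup_upper_bound hs) => /=; lra.
pose B : set R := [set y | exists2 u, 0 < u < sup S & y = g u] `|`
  [set y | exists2 u, sup S < u < 1 & y = f u].
have ubg v : sup S < v -> v < 1 -> ubound B (g v).
  move=> sv v1 _ [[u /andP[u0 us] ->]|[u /andP[su u1'] ->]].
    by apply: gm => //; lra.
  have [uv|/ltW vu] := leP u v.
    have u0 : 0 < u by lra.
    by apply: (le_trans (above _ su u1')); exact: gm.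
  have v0 : 0 < v by lra.
  by apply: (le_trans (fm _ _ v0 vu u1')); exact: above.
have ubf v : 0 < v -> v < sup S -> ubound B (f v).
  move=> v0 vs _ [[u /andP[u0 us] ->]|[u /andP[su u1'] ->]].
    have [uv|/ltW vu] := leP u v.
      have v1 : v < 1 by lra.
      by apply: (le_trans (gm _ _ u0 uv v1)); exact: below.
    have u1' : u < 1 by lra.
    by apply: (le_trans (below _ u0 us)); exact: fm.
  by apply: fm => //; lra.
pose z := (sup S + 1) / 2.
have z1 : sup S < z by rewrite /z; lra.
have z2 : z < 1 by rewrite /z; lra.
have hB : has_sup B.
  by split; [exists (f z); right; exists z; rewrite ?z1|exists (g z); exact: ubg].
exists (sup S), (sup B); split; first by lra.
move=> u /andP[u0 u1']; split => [us|su]; apply/andP; split.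
- by apply: (sup_upper_bound hB); left; exists u; rewrite ?u0.
- by apply: (ge_sup hB.1); exact: ubf.
- by apply: (sup_upper_bound hB); right; exists u; rewrite ?su.
- by apply: (ge_sup hB.1); exact: ubg.
Qed.

(** * The support of nu and the endpoint condition *)

Section Support.
Context (R : realType) (w : R) (nu : probability (measurableTypeR R) R)
  (nu_atomless : atomless nu)
  (nu_integrable : nu.-integrable setT (EFin \o id : R -> \bar R))
  (nu_mean : (\int[nu]_x x%:E = w%:E)%E).
Notation F := (lcdf nu).

Let FM : moment_cdf w F (lmoment nu w) := law_moment_cdf nu_atomless nu_integrable nu_mean.

(** The quantile c = inf {F > v} is a point of increase: F <= v before c and F > v after it, so each
    neighbourhood of c has positive mass. *)
Lemma support_quantile v : 0 < v < 1 -> exists2 c, topological_support nu c & F c = v.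
Proof.
move=> /andP[v0 v1]; pose S : set R := [set x | v < F x].
have hi : has_inf S.
  split.
    have v1' : 0 < 1 - v by lra.
    have [x0 Hx] := mc_F1 FM v1'; exists x0; change (v < F x0).
    have := Hx _ (lexx _); rewrite ltr_norml; lra.
  have [x0 Hx] := mc_F0 FM v0; exists x0 => x vx; have {}vx : v < F x := vx.
  rewrite leNgt; apply/negP => /ltW /(Hx x); rewrite ltr_norml; lra.
pose c := inf S.
have lowS x : x < c -> F x <= v.
  by move=> xc; rewrite leNgt; apply/negP => /(inf_lbound hi.2); rewrite -/c; lra.
have upS x : c < x -> v < F x.
  move=> cx; have xc : 0 < x - c by lra.
  have [y Sy yx] := inf_adherent xc hi.
  have yx' : y <= x by move: yx; rewrite -/c; lra.
  exact: lt_le_trans Sy (mc_mono FM yx').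
exists c.
- move=> U oU Uc; have : nbhs c U by exact: open_nbhs_nbhs.
  case/nbhs_ballP => d /= d0 dU.
  have dd : c - d / 2 <= c + d / 2 by lra.
  apply: (@lt_le_trans _ _ (nu `]c - d / 2, c + d / 2]%classic)).
    rewrite (lcdf_itv_oc nu dd) lte_fin subr_gt0.
    by apply: (@le_lt_trans _ _ v); [apply: lowS|apply: upS]; lra.
  apply: le_measure; rewrite ?inE//; first exact: open_measurable.
  move=> z; rewrite /= in_itv/= => zcd; apply: dU; rewrite /ball/= ltr_norml; lra.
- apply/eqP; rewrite eq_le; apply/andP; split; rewrite leNgt; apply/negP => h.
    have e0 : 0 < F c - v by lra.
    have [d d0 Hd] := cdf_close FM c e0.
    have := Hd (c - d / 2); have := lowS (c - d / 2).
    by rewrite !ltr_norml => /(_ ltac:(lra)) h1 /(_ ltac:(lra)); lra.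
  have e0 : 0 < v - F c by lra.
  have [d d0 Hd] := cdf_close FM c e0.
  have := Hd (c + d / 2); have := upS (c + d / 2).
  by rewrite !ltr_norml => /(_ ltac:(lra)) h1 /(_ ltac:(lra)); lra.
Qed.

(** Puts the left endpoint strictly below w, so that the denominator of [left_ratio] is positive. *)
Lemma support_lt_mean : exists2 c, topological_support nu c & c < w.
Proof.
have Fw0 := cdf_mean_gt0 FM; have Fw1 := cdf_mean_lt1 FM.
have [c sc Fc] := @support_quantile (F w / 2) ltac:(lra); exists c => //.
by rewrite ltNge; apply/negP => /(mc_mono FM); lra.
Qed.

Lemma support_gt_mean : exists2 c, topological_support nu c & w < c.
Proof.
have Fw0 := cdf_mean_gt0 FM; have Fw1 := cdf_mean_lt1 FM.
have [c sc Fc] := @support_quantile ((F w + 1) / 2) ltac:(lra); exists c => //.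
by rewrite ltNge; apply/negP => /(mc_mono FM); lra.
Qed.

Lemma lcdf_gt0 y : (left_endpoint nu < y%:E)%E -> 0 < F y.
Proof.
move=> /ereal_inf_lt[_ [x sx <-]]; rewrite lte_fin => xy.
have o : open (`]-oo, y[%classic : set R) by exact: interval_open.
have := sx _ o; rewrite /= in_itv/= => /(_ xy) nu0.
have fin : nu `]-oo, y]%classic \is a fin_num by exact: fin_num_measure.
rewrite -lte_fin /lcdf fineK//; apply: (lt_le_trans nu0).
by apply: le_measure; rewrite ?inE// => z /=; rewrite !in_itv/= => /ltW.
Qed.

Lemma lcdf_lt1 y : (y%:E < right_endpoint nu)%E -> F y < 1.
Proof.
move=> /ereal_sup_gt[_ [x sx <-]]; rewrite lte_fin => xy.
have o : open (`]y, +oo[%classic : set R) by exact: interval_open.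
have := sx _ o; rewrite /= in_itv/= andbT => /(_ xy) nu0.
have := lcdf_compl nu y.
rewrite Rintegral_cst// mul1r => h.
have fin : nu `]y, +oo[%classic \is a fin_num by exact: fin_num_measure.
have : 0 < fine (nu `]y, +oo[%classic) by rewrite fine_gt0// nu0/= ltey_eq fin.
by rewrite -h subr_gt0.
Qed.

(** The point w + (K1 - w) / k is where the line of slope -k through (w, K1 - w) vanishes. The ratio
    0 of an infinite endpoint admits every k > 0. *)
Lemma right_endpoint_gt K1 k : w < K1 -> right_ratio nu w K1 < k -> 0 < k ->
  ((w + (K1 - w) / k)%:E < right_endpoint nu)%E.
Proof.
move=> wK + k0; rewrite /right_ratio; have [c sc wc] := support_gt_mean.
have : (c%:E <= right_endpoint nu)%E by apply: ereal_sup_ubound; exists c.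
case: (right_endpoint nu) => [r| |]; rewrite ?ltry// lee_fin lte_fin => cr.
have rw : 0 < r - w by lra.
rewrite ltr_pdivrMr// => h; rewrite -ltrBrDl ltr_pdivrMr//; lra.
Qed.

(** The point w - (K1 - K2) / (1 - k) is where the line of slope -k through (w, K1 - w) meets K2 -
    z. The ratio 1 of an infinite endpoint admits every k < 1. *)
Lemma left_endpoint_lt K1 K2 k : k < left_ratio nu w K1 K2 -> k < 1 ->
  (left_endpoint nu < (w - (K1 - K2) / (1 - k))%:E)%E.
Proof.
move=> + k1; rewrite /left_ratio; have [c sc wc] := support_lt_mean.
have : (left_endpoint nu <= c%:E)%E by apply: ereal_inf_lbound; exists c.
case: (left_endpoint nu) => [l| |]; rewrite ?ltNyr// lee_fin lte_fin => cr.
have rw : 0 < w - l by lra.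
rewrite ltr_pdivlMr// => h.
suff : (K1 - K2) / (1 - k) < w - l by lra.
by rewrite ltr_pdivrMr; lra.
Qed.

Lemma right_ratio_ge0 K1 : w < K1 -> 0 <= right_ratio nu w K1.
Proof.
move=> wK; rewrite /right_ratio; have [c sc wc] := support_gt_mean.
have : (c%:E <= right_endpoint nu)%E by apply: ereal_sup_ubound; exists c.
case: (right_endpoint nu) => [r| |] //; rewrite lee_fin => cr.
by apply: divr_ge0; lra.
Qed.

Lemma left_ratio_le1 K1 K2 : K2 < K1 -> left_ratio nu w K1 K2 <= 1.
Proof.
move=> KK; rewrite /left_ratio; have [c sc wc] := support_lt_mean.
have : (left_endpoint nu <= c%:E)%E by apply: ereal_inf_lbound; exists c.
case: (left_endpoint nu) => [l| |] //; rewrite lee_fin => cr.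
by rewrite ler_pdivrMr; lra.
Qed.

End Support.

(** * Strong duality *)

(* With k(z) = (K2 - z)^+, the slopes of the chords from (w, K1 - w) to
   (r, k(r)) for r < w, and to (s, k(s)) for s > w. *)
Section ChordSlopes.
Context (R : realType) (w K1 K2 : R).

Definition left_slope (r : R) : R :=
  Num.min ((K1 - K2) / (w - r) - 1) ((K1 - w) / (w - r)).

Definition right_slope (s : R) : R :=
  Num.max (- ((K1 - K2) / (s - w)) - 1) (- ((K1 - w) / (s - w))).

(** K1 - K2 and K1 - w are positive, so both quotients grow as r approaches w. *)
Lemma left_slope_homo r r' : K2 < K1 -> w < K1 -> r <= r' -> r' < w -> left_slope r <= left_slope r'.
Proof.
move=> KK wK rr rw; have h : (w - r)^-1 <= (w - r')^-1 by rewrite lef_pV2 ?posrE; lra.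
have h1 : (K1 - K2) / (w - r) <= (K1 - K2) / (w - r') by rewrite ler_wpM2l//; lra.
have h2 : (K1 - w) / (w - r) <= (K1 - w) / (w - r') by rewrite ler_wpM2l//; lra.
rewrite /left_slope le_min !ge_min; apply/andP; split; apply/orP; [left|right] => //.
lra.
Qed.

Lemma right_slope_homo s s' : K2 < K1 -> w < K1 -> w < s -> s <= s' -> right_slope s <= right_slope s'.
Proof.
move=> KK wK ws ss; have h : (s' - w)^-1 <= (s - w)^-1 by rewrite lef_pV2 ?posrE; lra.
have h1 : (K1 - K2) / (s' - w) <= (K1 - K2) / (s - w) by rewrite ler_wpM2l//; lra.
have h2 : (K1 - w) / (s' - w) <= (K1 - w) / (s - w) by rewrite ler_wpM2l//; lra.
rewrite /right_slope ge_max !le_max; apply/andP; split; apply/orP; [left|right]; lra.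
Qed.

Definition line (b z : R) : R := K1 - w + b * (z - w).

Lemma line_above_left b r : r < w -> b <= left_slope r -> Num.max (K2 - r) 0 <= line b r.
Proof.
move=> rw; rewrite /left_slope le_min lerBrDr !ler_pdivlMr ?subr_gt0// => /andP[h1 h2].
by rewrite ge_max /line; apply/andP; split; lra.
Qed.

Lemma line_below_left b r : r < w -> left_slope r <= b -> line b r <= Num.max (K2 - r) 0.
Proof.
move=> rw; rewrite /left_slope ge_min lerBlDr !ler_pdivrMr ?subr_gt0// => h.
by rewrite le_max /line; case/orP: h => h; apply/orP; [left|right]; lra.
Qed.

Lemma line_above_right b s : w < s -> right_slope s <= b -> Num.max (K2 - s) 0 <= line b s.
Proof.
move=> ws; rewrite /right_slope -!mulNr ge_max lerBlDr !ler_pdivrMr ?subr_gt0// => /andP[h1 h2].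
by rewrite ge_max /line; apply/andP; split; lra.
Qed.

Lemma line_below_right b s : w < s -> b <= right_slope s -> line b s <= Num.max (K2 - s) 0.
Proof.
move=> ws; rewrite /right_slope -!mulNr le_max lerBrDr !ler_pdivlMr ?subr_gt0// => h.
by rewrite le_max /line; case/orP: h => h; apply/orP; [left|right]; lra.
Qed.

Definition hedge_claim (b z : R) : R := Num.max (line b z) (Num.max (K2 - z) 0).

Lemma hedge_claim_admissible b : dual_admissible K2 (hedge_claim b).
Proof.
split; last by move=> z; rewrite /hedge_claim le_max lexx orbT.
apply/convex_functionP => t x y t01; rewrite /hedge_claim.
set mx := Num.max (line b x) _; set my := Num.max (line b y) _.
have [x1 x2 x3] : [/\ line b x <= mx, K2 - x <= mx & 0 <= mx].
  by rewrite /mx; split; rewrite !le_max lexx ?orbT.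
have [y1 y2 y3] : [/\ line b y <= my, K2 - y <= my & 0 <= my].
  by rewrite /my; split; rewrite !le_max lexx ?orbT.
have tx0 : 0 <= t by lra.
have ty0 : 0 <= 1 - t by lra.
have X1 := ler_wpM2l tx0 x1; have X2 := ler_wpM2l tx0 x2; have X3 := ler_wpM2l tx0 x3.
have Y1 := ler_wpM2l ty0 y1; have Y2 := ler_wpM2l ty0 y2; have Y3 := ler_wpM2l ty0 y3.
rewrite !ge_max; apply/and3P; split; rewrite ?/line in X1 Y1 *; lra.
Qed.

End ChordSlopes.

Section StrongDuality.
Context (R : realType) (w K1 K2 : R) (nu : probability (measurableTypeR R) R)
  (nu_atomless : atomless nu)
  (nu_integrable : nu.-integrable setT (EFin \o id : R -> \bar R))
  (nu_mean : (\int[nu]_x x%:E = w%:E)%E)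
  (K2_lt_K1 : K2 < K1) (w_lt_K1 : w < K1)
  (endpoint_cond : right_ratio nu w K1 < left_ratio nu w K1 K2)
  (lo hi : R -> R) (lohi : barycentric_intervals nu w lo hi).
Notation T := (measurableTypeR R).
Notation P := (uniform_square R).

Let lo_lt u : 0 < u < 1 -> lo u < w.
Proof. exact: (barycentric_lo_lt nu_atomless nu_integrable nu_mean lohi). Qed.
Let hi_gt u : 0 < u < 1 -> w < hi u.
Proof. exact: (barycentric_hi_gt nu_atomless nu_integrable nu_mean lohi). Qed.
Let FM := law_moment_cdf nu_atomless nu_integrable nu_mean.

Lemma integrable_affine (p q : R) : nu.-integrable setT (EFin \o (fun z => p + q * z)).
Proof.
have i1 : nu.-integrable setT (EFin \o (cst p : R -> R)).
  exact: finite_measure_integrable_cst.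
have i2 : nu.-integrable setT (EFin \o (fun z : R => q * z)).
  exact: (integrableZl measurableT q nu_integrable).
exact: (integrableD measurableT i1 i2).
Qed.

Lemma hedge_claim_integrable b : nu.-integrable setT (EFin \o hedge_claim w K1 K2 b).
Proof.
have i1 := integrable_norm (integrable_affine (K1 - w - b * w) b).
have i2 := integrable_norm (integrable_affine K2 (- 1)).
have i3 : nu.-integrable setT (EFin \o (fun z => `|K1 - w - b * w + b * z| + `|K2 + - 1 * z|)).
  exact: (integrableD measurableT i1 i2).
apply: le_integrable i3 => //.
  by apply/measurable_EFinP; apply: convex_measurable; case: (hedge_claim_admissible w K1 K2 b).
move=> z _ /=; rewrite lee_fin; set p := `|K1 - w - b * w + b * z|; set q := `|K2 + - 1 * z|.
have h1 : line w K1 b z <= p by rewrite (le_trans _ (ler_norm _))// /line; lra.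
have h2 : K2 - z <= q by rewrite (le_trans _ (ler_norm _))//; lra.
have p0 : 0 <= p by exact: normr_ge0.
have q0 : 0 <= q by exact: normr_ge0.
rewrite (ger0_norm (_ : 0 <= p + q)) ?addr_ge0// ger0_norm.
  by rewrite /hedge_claim !ge_max; apply/and3P; split; lra.
by rewrite /hedge_claim !le_max lexx !orbT.
Qed.

Lemma slopes_cross : exists2 u, 0 < u < 1 &
  left_slope w K1 K2 (lo u) < right_slope w K1 K2 (hi u).
Proof.
have KK := K2_lt_K1; have wK := w_lt_K1; have ec := endpoint_cond.
have r0 := right_ratio_ge0 nu_atomless nu_integrable nu_mean w_lt_K1.
have l1 := left_ratio_le1 nu_atomless nu_integrable nu_mean K2_lt_K1.
set rr := right_ratio nu w K1 in r0 ec.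
set ll := left_ratio nu w K1 K2 in l1 ec.
(* Two values between the ratios, hence in ]0, 1[; a single one would give only a weak inequality
   between the slopes. *)
pose k1 := (2 * rr + ll) / 3; pose k2 := (rr + 2 * ll) / 3.
have k10 : 0 < k1 by rewrite /k1; lra.
have k12 : k1 < k2 by rewrite /k1 /k2; lra.
have k21 : k2 < 1 by rewrite /k2; lra.
have rk1 : right_ratio nu w K1 < k1 by rewrite -/rr /k1; lra.
have k2l : k2 < left_ratio nu w K1 K2 by rewrite -/ll /k2; lra.
have := right_endpoint_gt nu_atomless nu_integrable nu_mean w_lt_K1 rk1 k10.
have := left_endpoint_lt nu_atomless nu_integrable nu_mean k2l k21.
set b := w + (K1 - w) / k1; set a := w - (K1 - K2) / (1 - k2).
move=> /lcdf_gt0 Fa /lcdf_lt1 Fb.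
have da : 0 < (K1 - K2) / (1 - k2) by apply: divr_gt0; lra.
have db : 0 < (K1 - w) / k1 by apply: divr_gt0; lra.
have wa : w - a = (K1 - K2) / (1 - k2) by rewrite /a; ring.
have bw : b - w = (K1 - w) / k1 by rewrite /b; ring.
have aw : a < w by rewrite -subr_gt0 wa.
have wb : w < b by rewrite -subr_gt0 bw.
have sa : left_slope w K1 K2 a <= - k2.
  rewrite /left_slope ge_min wa; apply/orP; left.
  rewrite invf_div mulrCA divff ?mulr1; first by lra.
  by rewrite gt_eqF// subr_gt0.
have sb : - k1 <= right_slope w K1 K2 b.
  rewrite /right_slope le_max bw; apply/orP; right.
  by rewrite invf_div mulrCA divff ?mulr1// gt_eqF// subr_gt0.
have Fb0 := mcdf_ge0 FM b; have Fa1 := mcdf_le1 FM a.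
(* An interval of mass u > m must contain a and b: with left end beyond a its mass is at most 1 -
   F(a), with right end before b at most F(b). *)
pose m := Num.max (1 - lcdf nu a) (lcdf nu b).
have m1 : 1 - lcdf nu a <= m by rewrite /m le_max lexx.
have m2 : lcdf nu b <= m by rewrite /m le_max lexx orbT.
have m3 : m < 1 by rewrite /m gt_max; apply/andP; split; lra.
pose u := (m + 1) / 2.
have mu : m < u by rewrite /u; lra.
have u01 : 0 < u < 1 by rewrite /u; lra.
have [_ _ H] := proj1 (barycentric_cdf w nu_atomless nu_integrable lo hi) lohi.
have [_ Fu _] := H u ltac:(by rewrite in_itv).
exists u => //.
have lu : lo u <= a.
  rewrite leNgt; apply/negP => /ltW /(mc_mono FM).
  by have := mcdf_le1 FM (hi u); lra.
have hu : b <= hi u.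
  rewrite leNgt; apply/negP => /ltW /(mc_mono FM).
  by have := mcdf_ge0 FM (lo u); lra.
have := left_slope_homo K2_lt_K1 w_lt_K1 lu aw.
have := right_slope_homo K2_lt_K1 w_lt_K1 wb hu; lra.
Qed.

(** At U = u0 the crossing says nothing about the slopes, and off ]0, 1[ nothing is known of lo and
    hi; both cases are null. *)
Let outside (u0 : R) : set T := ~` `]0, 1[%classic `|` [set u0].

Let null_outside (u0 : R) : P (fst @^-1` outside u0 : set (T * T)) = 0%E.
Proof.
have m1 : measurable (~` `]0, 1[%classic : set T) by apply: measurableC.
have mB : measurable (outside u0) by apply: measurableU.
have -> : fst @^-1` outside u0 = (outside u0 `*` setT : set (T * T)).
  by apply/seteqP; split => x /=; [|case].
have h : P (outside u0 `*` setT) = (uniform01 R (outside u0) * uniform01 R setT)%E.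
  exact: (@product_measure1E _ _ T T R (uniform01 R) (uniform01 R)).
rewrite h; suff -> : uniform01 R (outside u0) = 0%E by rewrite mul0e.
apply/eqP; rewrite eq_le measure_ge0 andbT.
apply: (le_trans (measureU2 _ m1 _)) => //.
pose I01 : set T := `]0, 1[%classic.
have e1 : uniform01 R (~` I01) = (1 - uniform01 R I01)%E.
  by apply: probability_setC; exact: measurable_itv.
have e2 : uniform01 R I01 = (1 - 0)%:E by apply: uniform01_oo; lra.
have e3 : uniform01 R [set u0] = 0%E.
  rewrite uniform01E//; apply/eqP; rewrite eq_le measure_ge0 andbT.
  rewrite -(lebesgue_measure_set1 u0); apply: le_measure; rewrite ?inE//.
  exact: measurableI.
by rewrite [X in (X + _)%E]e1 [X in (_ + X)%E]e3 e2 subr0 subee// adde0.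
Qed.

Lemma strong_duality : exists2 u, u \in `[0, 1] &
  (dual_bound nu w K1 K2 <= threshold_value w lo hi K1 K2 u)%E.
Proof.
have [u1 u101 su1] := slopes_cross.
have [lo_mono hi_mono _] := lohi.
have fm u v : 0 < u -> u <= v -> v < 1 ->
    left_slope w K1 K2 (lo v) <= left_slope w K1 K2 (lo u).
  move=> u0 uv v1; have u01 : 0 < u < 1 by lra.
  by apply: left_slope_homo => //; [apply: lo_mono; rewrite ?in_itv/=; lra|exact: lo_lt].
have gm u v : 0 < u -> u <= v -> v < 1 ->
    right_slope w K1 K2 (hi u) <= right_slope w K1 K2 (hi v).
  move=> u0 uv v1; have u01 : 0 < u < 1 by lra.
  by apply: right_slope_homo => //; [exact: hi_gt|apply: hi_mono; rewrite ?in_itv/=; lra].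
have [u0 [b [u001 H]]] := monotone_crossing fm gm u101 su1.
exists u0; first by rewrite in_itv/=; lra.
have mN : measurable (fst @^-1` outside u0 : set (T * T)).
  rewrite -[X in measurable X]setTI.
  have fstm : measurable_fun setT (fst : T * T -> T) by exact: measurable_fst.
  by apply: (fstm measurableT); apply: measurableU => //; exact: measurableC.
have M := interval_model_consistent nu_atomless nu_integrable nu_mean lohi.
have tauF := threshold_exercise_time u0.
have K1w : Num.max (K1 - w) 0 = K1 - w by apply: max_l; rewrite subr_ge0 ltW.
rewrite /threshold_value (hedge_eq_price (b := b) (c := 0) (f := hedge_claim w K1 K2 b)
  M tauF (hedge_claim_integrable b) mN (null_outside u0)).
  apply: ereal_inf_lbound; exists (hedge_claim w K1 K2 b); first exact: hedge_claim_admissible.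
  rewrite /dual_cost; congr (_%:E + _)%E.
  (* psi(w) >= L(w) = K1 - w, so the cash term of the dual cost vanishes. *)
  rewrite K1w; apply: max_r; rewrite subr_le0 /hedge_claim /line subrr mulr0 addr0.
  by rewrite le_max lexx.
move=> [U V] nN.
have U01 : 0 < U < 1.
  by apply: contrapT => h; apply: nN; left => /=; rewrite in_itv.
have Uu0 : U != u0 by apply/eqP => h; apply: nN; right.
have lU := lo_lt U01; have hU := hi_gt U01.
have [Hlt Hgt] := H U U01.
rewrite (put_payoffE _ _ _ tauF) /hedge add0r /interval_process /=.
set X2 := terminal_value w lo hi (U, V).
have X2E : X2 = lo U \/ X2 = hi U.
  by rewrite /X2 terminal_valueE /= in_itv/= U01; case: ifP; [left|right].
have [Ult|Ugt|UE] := ltgtP U u0; last by rewrite UE eqxx in Uu0.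
(* Exercise at date 1: psi(X_2) = L(X_2), and shorting b units of stock at w leaves exactly L(w) =
   K1 - w. *)
- have tE : (threshold_time u0 (U, V) <= t1)%N by rewrite /threshold_time /= Ult.
  rewrite tE indicE mem_set//= mul1r K1w.
  have /andP[b1 b2] := Hlt Ult.
  have above : Num.max (K2 - X2) 0 <= line w K1 b X2.
    by case: X2E => ->; [exact: line_above_left|exact: line_above_right].
  have -> : hedge_claim w K1 K2 b X2 = line w K1 b X2 by apply: max_l.
  by rewrite /line /X2 /=; ring.
(* No exercise at date 1: psi(X_2) = (K2 - X_2)^+ and no stock is held. *)
- have tE : (threshold_time u0 (U, V) <= t1)%N = false.
    by rewrite /threshold_time /= ltNge (ltW Ugt).
  rewrite tE indicE memNset//=; last by rewrite tE.
  have /andP[b1 b2] := Hgt Ugt.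
  have below : line w K1 b X2 <= Num.max (K2 - X2) 0.
    by case: X2E => ->; [exact: line_below_left|exact: line_below_right].
  by rewrite mul0r mulr0 subr0 /hedge_claim; apply/esym; exact: max_r.
Qed.

End StrongDuality.

Unset Implicit Arguments.

(** Gaps of nu leave a choice of R and S, so the equalities are proved for every choice; the
    existence part shows that there is one. *)
Theorem mainTheorem2 (R : realType) (w K1 K2 : R) (nu : probability (measurableTypeR R) R)
    (nu_atomless : atomless nu)
    (nu_integrable : nu.-integrable setT (EFin \o id : R -> \bar R))
    (nu_mean : (\int[nu]_x x%:E = w%:E)%E)
    (K2_lt_K1 : K2 < K1) (w_lt_K1 : w < K1)
    (endpoint_cond : right_ratio nu w K1 < left_ratio nu w K1 K2) :
  (exists lo hi : R -> R, barycentric_intervals nu w lo hi) /\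
  (forall lo hi : R -> R, barycentric_intervals nu w lo hi ->
    highest_model_price (@dirac _ (measurableTypeR R) w R) nu K1 K2 =
      ereal_sup [set threshold_value w lo hi K1 K2 u | u in `[0, 1]] /\
    ereal_sup [set threshold_value w lo hi K1 K2 u | u in `[0, 1]] =
      dual_bound nu w K1 K2).
Proof.
split; first exact: barycentric_intervals_exist nu_atomless nu_integrable nu_mean.
move=> lo hi lohi.
pose A : set (\bar R) := [set threshold_value w lo hi K1 K2 u | u in `[0, 1]].
have weak := weak_duality w K1 K2 nu.
have threshold : (ereal_sup A <=
    highest_model_price (@dirac _ (measurableTypeR R) w R) nu K1 K2)%E.
  apply: ge_ereal_sup => _ [u _ <-].
  exact: threshold_le_highest nu_atomless nu_integrable nu_mean lo hi lohi K1 K2 u.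
have strong : (dual_bound nu w K1 K2 <= ereal_sup A)%E.
  have [u u01 h] := strong_duality nu_atomless nu_integrable nu_mean K2_lt_K1 w_lt_K1
    endpoint_cond lohi.
  by apply: (le_trans h); apply: ereal_sup_ubound; exists u.
rewrite -/A; split; apply/eqP; rewrite eq_le.
  by rewrite threshold (le_trans weak strong).
by rewrite strong (le_trans threshold weak).
Qed.
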